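(* Let $n\ge1$, $L=\operatorname{diag}(x^1,\dots,x^n)$, $g_{\mathsf{LC}}=\sum_{s=1}^n\bigl(\prod_{j\ne s}(x^s-x^j)\bigr)^{-1}(\partial/\partial x^s)^2$, and let $P(t)=-4c\,(t-\mu_1)^{k_1}\cdots(t-\mu_m)^{k_m}$ with $c\neq0$, pairwise distinct (possibly complex) $\mu_i$, and $d:=n-(k_1+\dots+k_m)\ge0$. Consider the flat contravariant metric $g=P(L)g_{\mathsf{LC}}$, i.e. $g^{ss}=P(x^s)/\prod_{j\neq s}(x^s-x^j)$. Define, using any local branch of the square root, $Y_i^\alpha=\frac{1}{\alpha!}\frac{d^\alpha}{dt^\alpha}\sqrt{\det(t\operatorname{Id}-L)}\Big|_{t=\mu_i}$ for $i=1,\dots,m$, $\alpha=0,\dots,k_i-1$, and $Y_\infty^\alpha=\frac{1}{\alpha!}\frac{d^\alpha}{dt^\alpha}\sqrt{\det(\operatorname{Id}-tL)}\Big|_{t=0}-R^{(\alpha)}$ for $\alpha=1,\dots,d$, where $R^{(\alpha)}=\frac{1}{\alpha!}\frac{d^\alpha}{dt^\alpha}\prod_{i=1}^m(1-t\mu_i)^{k_i}\Big|_{t=0}$. Then each of these $n$ functions $Y$ satisfies $\nabla\nabla Y=0$ ($\nabla$ the Levi-Civita connection of $g$), and they are independent, so they form flat coordinates for $g$. More precisely, with $\tilde P_i(t)=\prod_{s\neq i}(t-\mu_s)^{k_s}$, $\tilde P_i^{(k)}=\frac1{k!}\frac{d^k}{dt^k}\tilde P_i(t)|_{t=\mu_i}$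 (and $\tilde P_i^{(k)}=0$, $R^{(k)}=0$ for $k<0$): $g^*(dY_i^\alpha,dY_j^\beta)=0$ for $i\ne j$; $g^*(dY_i^\alpha,dY_i^\beta)=c\,\tilde P_i^{(\alpha+\beta-k_i+1)}$; $g^*(dY_i^\alpha,dY_\infty^\beta)=0$; $g^*(dY_\infty^\alpha,dY_\infty^\beta)=-c\,R^{(\alpha+\beta-d-1)}$, and the resulting constant $n\times n$ matrix is nondegenerate.
   Context: $g^*$ denotes the contravariant metric applied to covectors. A function $Y$ with $\nabla\nabla Y=0$ has covariantly constant differential; flat coordinates are $n$ functionally independent such functions. *)

(* Defs.v *)
From HB Require Import structures.
From mathcomp Require Import all_boot all_order all_algebra complex.
From mathcomp Require Import all_classical all_reals all_analysis.
Set Implicit Arguments. Unset Strict Implicit. Unset Printing Implicit Defensive.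
Import Order.TTheory GRing.Theory Num.Theory.
Import numFieldTopology.Exports numFieldNormedType.Exports.
Local Open Scope ring_scope.

Definition CC (R : realType) : numClosedFieldType := R[i].

Section Defs.
Variable R : realType.
Local Notation C := (CC R).
Variable n : nat.

Definition pd (s : 'I_n) (f : 'rV[C]_n -> C) : 'rV[C]_n -> C :=
  fun x => 'D_(delta_mx 0 s) f x.

(* A metric is given by its contravariant components ginv x = (g^{ij}(x));
   the covariant components are g_{ij} = (invmx (ginv x)) i j. *)
Definition christoffel (ginv : 'rV[C]_n -> 'M[C]_n) (x : 'rV[C]_n)
    (k i j : 'I_n) : C :=
  2^-1 * \sum_(l < n) ginv x k l *
    (pd i (fun y => invmx (ginv y) j l) x + pd j (fun y => invmx (ginv y) i l) x
     - pd l (fun y => invmx (ginv y) i j) x).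

Definition hessian (ginv : 'rV[C]_n -> 'M[C]_n) (Y : 'rV[C]_n -> C)
    (x : 'rV[C]_n) (i j : 'I_n) : C :=
  pd i (pd j Y) x - \sum_(k < n) christoffel ginv x k i j * pd k Y x.

Definition cometric (ginv : 'rV[C]_n -> 'M[C]_n) (F H : 'rV[C]_n -> C)
    (x : 'rV[C]_n) : C :=
  \sum_(i < n) \sum_(j < n) ginv x i j * pd i F x * pd j H x.

Definition PLCmetric (P : {poly C}) (x : 'rV[C]_n) : 'M[C]_n :=
  diag_mx (\row_s (P.[x 0 s] / \prod_(j < n | j != s) (x 0 s - x 0 j))).

Definition taylorY (sigma : 'rV[C]_n -> C -> C) (a : C) (alpha : nat)
    : 'rV[C]_n -> C :=
  fun x => (alpha`!%:R)^-1 * derive1n alpha (sigma x) a.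

End Defs.

Section Polys.
Variable R : realType.
Local Notation C := (CC R).
Variables (m : nat) (k : 'I_m -> nat) (mu : 'I_m -> C).

Definition Ppoly (c : C) : {poly C} :=
  (- 4 * c) *: \prod_(i < m) ('X - (mu i)%:P) ^+ (k i).

Definition Ptilde (i : 'I_m) : {poly C} :=
  \prod_(s < m | s != i) ('X - (mu s)%:P) ^+ (k s).

Definition Rpoly : {poly C} := \prod_(i < m) (1 - mu i *: 'X) ^+ (k i).

Definition tcoef (p : {poly C}) (a : C) (j : int) : C :=
  match j with Posz j' => (p^`N(j')).[a] | Negz _ => 0 end.

(* index set of the n functions: Y_i^alpha (i < m, alpha < k_i) and
   Y_infty^alpha (alpha = j+1, j < d) *)
Definition Idx (d : nat) : finType := ({i : 'I_m & 'I_(k i)} + 'I_d)%type.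

Definition Yfun (n d : nat) (sigma : 'I_m -> 'rV[C]_n -> C -> C)
    (sigmainf : 'rV[C]_n -> C -> C) (a : Idx d) : 'rV[C]_n -> C :=
  match a with
  | inl (existT i alpha) => taylorY (sigma i) (mu i) alpha
  | inr j => fun x => taylorY sigmainf 0 j.+1 x - tcoef Rpoly 0 (Posz j.+1)
  end.

Definition Gram (d : nat) (c : C) (a b : Idx d) : C :=
  match a, b with
  | inl (existT i alpha), inl (existT j beta) =>
      if i == j then
        c * tcoef (Ptilde i) (mu i)
              ((alpha : nat)%:Z + (beta : nat)%:Z - (k i)%:Z + 1)
      else 0
  | inr a', inr b' =>
      - c * tcoef Rpoly 0 ((a'.+1)%:Z + (b'.+1)%:Z - d%:Z - 1)
  | _, _ => 0
  end.

End Polys.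

(* Main.v *)
Require Import Defs.
From HB Require Import structures.
From mathcomp Require Import all_boot all_order all_algebra complex.
From mathcomp Require Import ring zify.
From mathcomp Require Import all_classical all_reals all_analysis.
Import Order.TTheory GRing.Theory Num.Theory.
Import numFieldTopology.Exports numFieldNormedType.Exports.
Set Implicit Arguments. Unset Strict Implicit. Unset Printing Implicit Defensive.
Local Open Scope ring_scope.

(** The functions Y are the coefficients of formal power series
    Y(tau) = sqrt (prod_s (p - x_s q)), with (p, q) = (mu_i + tau, 1) at mu_i and
    (p, q) = (1, tau) at infinity, so that both kinds of coordinates are treated
    at once. Differentiating Y^2 gives d_s Y = - q Y / (2 (p - x_s q)).
    Let Ph = q^n P(p/q). Expanding Ph / prod_s (p - x_s q) in partial fractions
    turns the diagonal Hessian components into multiples of q Ph, while the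
    off-diagonal ones vanish identically, and in two variables gives
      (p q' - q p') g*(dY, dY') = (q Y q' Ph' / Y' - q Ph / Y q' Y') / 4.
    As q Ph is divisible by tau^(k_i) (by tau^(d+1) at infinity), reading off the
    coefficients yields flatness and the Gram matrix; its diagonal blocks are
    anti-triangular Hankel matrices, hence it is invertible, and independence of
    the differentials follows. *)

(** * Formal power series *)

(** Each coordinate is an iterated derivative in t of a branch that is only assumed continuous, so
    differentiating it in x_s naively would mean exchanging derivatives in t and x. This is avoided:
    the Taylor coefficients satisfy the algebraic equation Y * Y = prod_s (p - x_s q) between formal
    series, which expresses them rationally through the constant term and the right-hand side. Only
    the constant term is differentiated by analysis; the rest is algebra of series at a fixed x. The
    root is not flat for arbitrary t. The order of vanishing of q Ph decides which coefficients are: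
    orders below k_i at mu_i, and orders up to d at infinity, where order 0 is a constant and is
    left out. In the Gram identity the factor p q' - q p' is invertible for different base points.
    For equal ones it is tau - upsilon up to sign, and dividing by it produces divided differences,
    whose coefficients depend only on the sum of the two orders. This is the origin of the Hankel
    form. *)

Definition fps (R : Type) := nat -> R.

Section FpsRing.
Variable R : comNzRingType.
Implicit Types f g h : fps R.

HB.instance Definition _ := gen_eqMixin (fps R).
HB.instance Definition _ := gen_choiceMixin (fps R).

Definition fps_zero : fps R := fun=> 0.
Definition fps_opp f : fps R := fun i => - f i.
Definition fps_add f g : fps R := fun i => f i + g i.
Definition fps_one : fps R := fun i => (i == 0)%:R.
Definition fps_mul f g : fps R := fun i => \sum_(j < i.+1) f j * g (i - j)%N.

Fact fps_addA : associative fps_add.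
Proof. by move=> f g h; apply/funext => i; exact: addrA. Qed.
Fact fps_addC : commutative fps_add.
Proof. by move=> f g; apply/funext => i; exact: addrC. Qed.
Fact fps_add0 : left_id fps_zero fps_add.
Proof. by move=> f; apply/funext => i; exact: add0r. Qed.
Fact fps_addN : left_inverse fps_zero fps_opp fps_add.
Proof. by move=> f; apply/funext => i; exact: addNr. Qed.

HB.instance Definition _ :=
  GRing.isZmodule.Build (fps R) fps_addA fps_addC fps_add0 fps_addN.

Let trunc n f : {poly R} := \poly_(i < n) f i.

(** Commutativity and associativity are inherited from polynomials: the coefficient of order i only
    sees truncations at any length beyond i. *)
Let fps_mul_trunc n f g i : (i < n)%N ->
  fps_mul f g i = (trunc n f * trunc n g)`_i.
Proof.
move=> lt_in; rewrite coefM; apply: eq_bigr => j _.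
by rewrite !coef_poly !(leq_ltn_trans _ lt_in) ?leq_subr // -ltnS.
Qed.

Fact fps_mulC : commutative fps_mul.
Proof.
by move=> f g; apply/funext => i; rewrite !(fps_mul_trunc _ _ (ltnSn i)) mulrC.
Qed.

Fact fps_mulA : associative fps_mul.
Proof.
have aux f g h i : fps_mul f (fps_mul g h) i =
    (trunc i.+1 f * (trunc i.+1 g * trunc i.+1 h))`_i.
  rewrite coefM; apply: eq_bigr => j _.
  by rewrite coef_poly ltn_ord (@fps_mul_trunc i.+1) // ltnS leq_subr.
move=> f g h; apply/funext => i.
by rewrite aux (fps_mulC (fps_mul f g)) aux mulrA mulrC.
Qed.

Fact fps_mul1 : left_id fps_one fps_mul.
Proof.
move=> f; apply/funext => i; rewrite /fps_mul big_ord_recl /= subn0 mul1r.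
by rewrite big1 ?addr0 // => j _; rewrite mul0r.
Qed.

Fact fps_mulDl : left_distributive fps_mul fps_add.
Proof.
move=> f g h; apply/funext => i; rewrite /fps_mul /fps_add -big_split.
by apply: eq_bigr => j _; rewrite mulrDl.
Qed.

Fact fps_one_neq0 : fps_one != 0.
Proof.
by apply/eqP => /(congr1 (fun f : fps R => f 0)) /eqP; rewrite /fps_one oner_eq0.
Qed.

HB.instance Definition _ := GRing.Zmodule_isComNzRing.Build (fps R)
  fps_mulA fps_mulC fps_mul1 fps_mulDl fps_one_neq0.

Lemma fpsD f g i : (f + g) i = f i + g i. Proof. by []. Qed.
Lemma fpsN f i : (- f) i = - f i. Proof. by []. Qed.
Lemma fps0 i : (0 : fps R) i = 0. Proof. by []. Qed.
Lemma fps1 i : (1 : fps R) i = (i == 0)%:R. Proof. by []. Qed.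
Lemma fpsM f g i : (f * g) i = \sum_(j < i.+1) f j * g (i - j)%N.
Proof. by []. Qed.
Lemma fpsM0 f g : (f * g) 0 = f 0 * g 0.
Proof. by rewrite fpsM big_ord1. Qed.

Lemma fps_sum (I : Type) (r : seq I) (P : pred I) (F : I -> fps R) i :
  (\sum_(k <- r | P k) F k) i = \sum_(k <- r | P k) F k i.
Proof. exact: (big_morph (fun f : fps R => f i) (fun f g => fpsD f g i)). Qed.

Definition fps_poly (p : {poly R}) : fps R := fun i => p`_i.

Fact fps_poly_zmod : zmod_morphism fps_poly.
Proof. by move=> p q; apply/funext => i; rewrite /fps_poly coefB. Qed.
Fact fps_poly_monoid : monoid_morphism fps_poly.
Proof.
split=> [|p q]; apply/funext => i; first by rewrite /fps_poly coef1.
by rewrite /fps_poly coefM.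
Qed.
HB.instance Definition _ :=
  GRing.isZmodMorphism.Build {poly R} (fps R) fps_poly fps_poly_zmod.
HB.instance Definition _ :=
  GRing.isMonoidMorphism.Build {poly R} (fps R) fps_poly fps_poly_monoid.

Definition fpsC (a : R) : fps R := fps_poly a%:P.
HB.instance Definition _ := GRing.RMorphism.copy fpsC (fps_poly \o polyC).

Lemma fpsCE a i : fpsC a i = if i == 0 then a else 0.
Proof. by rewrite /fpsC /fps_poly coefC. Qed.

Lemma fpsCM a f i : (fpsC a * f) i = a * f i.
Proof.
rewrite fpsM big_ord_recl fpsCE /= subn0 big1 ?addr0 // => j _.
by rewrite fpsCE mul0r.
Qed.

Definition fpsX : fps R := fps_poly 'X.

Lemma fpsXnM k f i : (fpsX ^+ k * f) i = if (i < k)%N then 0 else f (i - k)%N.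
Proof.
rewrite -rmorphXn /=; case: ltnP => [lt_ik|le_ki].
  rewrite fpsM big1 // => j _; rewrite /fps_poly coefXn.
  by rewrite ltn_eqF ?mul0r // (leq_trans (ltn_ord j)).
rewrite fpsM (bigD1 (Ordinal (le_ki : (k < i.+1)%N))) //= big1.
  by rewrite /fps_poly coefXn eqxx mul1r addr0.
move=> j jk; rewrite /fps_poly coefXn -val_eqE /= in jk *.
by rewrite (negPf jk) mul0r.
Qed.

Lemma fpsXM f i : (fpsX * f) i = if i is j.+1 then f j else 0.
Proof. by rewrite -[fpsX]expr1 fpsXnM; case: i => // i; rewrite subn1. Qed.

Lemma fps_decomp f : f = fpsC (f 0) + fpsX * (fun i => f i.+1 : R).
Proof.
apply/funext => i; rewrite fpsD fpsCE fpsXM; case: i => [|i] /=.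
  by rewrite addr0.
by rewrite add0r.
Qed.

(* 1 / (1 - e) is the geometric series of e when e has no constant term. *)
Lemma fps_inv f a : f 0 * a = 1 -> exists g, f * g = 1.
Proof.
move=> fa1; pose e := 1 - fpsC a * f.
have [e' eX] : exists e', e = fpsX * e'.
  exists (fun i => e i.+1); rewrite {1}[e]fps_decomp.
  by rewrite /e fpsD fpsN fpsCM mulrC fa1 subrr rmorph0 add0r.
pose s n := \sum_(k < n) e ^+ k.
(* As [e] is a multiple of [fpsX], its k-th power has no coefficient below order k, so each
   coefficient of the partial sums becomes stationary; [t] collects the limits. *)
have sS n k : (n < k)%N -> s k n = s n.+1 n.
  move=> /subnKC <-; elim: (k - n.+1)%N => [|m IH]; first by rewrite addn0.
  rewrite addnS; have -> : s (n.+1 + m).+1 = s (n.+1 + m)%N + e ^+ (n.+1 + m).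
    by rewrite /s big_ord_recr.
  by rewrite fpsD IH eX exprMn fpsXnM leq_addr addr0.
pose t : fps R := fun n => s n.+1 n.
exists (fpsC a * t); rewrite mulrCA mulrA.
have -> : fpsC a * f = 1 - e by rewrite /e opprB addrC subrK.
apply/funext => n.
have -> : ((1 - e) * t) n = ((1 - e) * s n.+1) n.
  rewrite !fpsM; apply: eq_bigr => j _; congr (_ * _).
  by rewrite [RHS]sS // ltnS leq_subr.
rewrite /s -opprB mulNr -subrX1 opprB fpsD fpsN eX exprMn fpsXnM ltnSn.
by rewrite subr0.
Qed.

End FpsRing.

Arguments fpsX {R}.

(** * Power series in two variables *)

Section Bivariate.
Variable R : comNzRingType.
Implicit Types (f g : fps R) (F : fps (fps R)).

(* F b a is the coefficient of tau^a upsilon^b;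
   finl f = f(tau) and finr g = g(upsilon). *)
Definition finl f : fps (fps R) := fpsC f.
Definition finr g : fps (fps R) := fun i => fpsC (g i).

HB.instance Definition _ := GRing.RMorphism.copy finl (@fpsC (fps R)).

Fact finr_zmod : zmod_morphism finr.
Proof. by move=> f g; apply/funext => i; rewrite /finr fpsD fpsN rmorphB. Qed.
Fact finr_monoid : monoid_morphism finr.
Proof.
split=> [|f g]; apply/funext => i.
  by rewrite /finr !fps1 rmorph_nat.
by rewrite /finr !fpsM rmorph_sum; apply: eq_bigr => j _; rewrite rmorphM.
Qed.
HB.instance Definition _ :=
  GRing.isZmodMorphism.Build (fps R) (fps (fps R)) finr finr_zmod.
HB.instance Definition _ :=
  GRing.isMonoidMorphism.Build (fps R) (fps (fps R)) finr finr_monoid.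

Lemma finl_coef f F a b : (finl f * F) b a = (f * F b) a.
Proof. by rewrite fpsCM. Qed.

Lemma finlr_coef f g a b : (finl f * finr g) b a = f a * g b.
Proof. by rewrite finl_coef mulrC fpsCM mulrC. Qed.

Lemma finlC a : finl (fpsC a) = finr (fpsC a).
Proof.
apply/funext => i; rewrite /finl /finr !fpsCE.
by case: eqP => // _; rewrite rmorph0.
Qed.

Lemma finrX : finr fpsX = fpsX.
Proof.
by apply/funext => i; rewrite /finr /fpsX /fps_poly !coefX rmorph_nat.
Qed.

Lemma finlXnM k F a b :
  (finl fpsX ^+ k * F) b a = if (a < k)%N then 0 else F b (a - k)%N.
Proof. by rewrite -rmorphXn finl_coef fpsXnM. Qed.

Lemma finrXnM k F a b :
  (finr fpsX ^+ k * F) b a = if (b < k)%N then 0 else F (b - k)%N a.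
Proof. by rewrite finrX fpsXnM; case: ifP. Qed.

Lemma subX_coef F a b : ((finl fpsX - finr fpsX) * F) b a =
  (if a is a'.+1 then F b a' else 0) - (if b is b'.+1 then F b' a else 0).
Proof.
rewrite mulrBl fpsD fpsD fpsN fpsN finl_coef fpsXM finrX fpsXM.
by case: b.
Qed.

(** So tau - upsilon can be cancelled over any coefficient ring: the coefficients of the product
    relate F at (a + 1, b) to F at (a, b + 1), and those with a = 0 vanish outright. *)
Lemma subX_eq0 F : (finl fpsX - finr fpsX) * F = 0 -> F = 0.
Proof.
move=> F0; have e a b : ((finl fpsX - finr fpsX) * F) b a = 0 by rewrite F0.
apply/funext => b; apply/funext => a; rewrite !fps0.
elim: a b => [|a IH] b.
  by have := e 0 b.+1; rewrite subX_coef => /eqP; rewrite sub0r oppr_eq0 => /eqP.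
by have := e a.+1 b.+1; rewrite subX_coef IH sub0r => /eqP; rewrite oppr_eq0 => /eqP.
Qed.

(* the divided difference (f(tau) - f(upsilon)) / (tau - upsilon) *)
Definition divdiff f : fps (fps R) := fun b a => f (a + b).+1.

Lemma divdiffE f : finl f - finr f = (finl fpsX - finr fpsX) * divdiff f.
Proof.
apply/funext => b; apply/funext => a; rewrite subX_coef.
rewrite !fpsD !fpsN /finl /finr /divdiff.
case: a b => [|a] [|b]; rewrite !fpsCE ?addn0 ?add0n ?addnS ?addSn ?subrr //=;
  by rewrite !(fps0, sub0r, subr0, oppr0, subrr).
Qed.

End Bivariate.

(** * Coefficientwise derivatives *)

Section Derive.
Variables (K : numFieldType) (V : normedModType K).
Local Open Scope classical_set_scope.
Local Open Scope ring_scope.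
Implicit Types (f h : V -> K) (F G : V -> fps K) (x v : V).

Lemma near_is_derive f g x v df :
  (\forall y \near x, f y = g y) -> is_derive x v f df -> is_derive x v g df.
Proof. exact: near_eq_is_derive. Qed.

Lemma is_derive_unique f x v (df dg : K) :
  is_derive x v f df -> is_derive x v f dg -> df = dg.
Proof. by move=> [_ <-] [_ <-]. Qed.

Lemma is_deriveMf f g x v (df dg : K) :
  is_derive x v f df -> is_derive x v g dg ->
  is_derive x v (fun y => f y * g y) (df * g x + f x * dg).
Proof.
move=> df' dg'; apply: is_derive_eq (is_deriveM df' dg') _.
by rewrite addrC /GRing.scale /= [g x * _]mulrC.
Qed.

Lemma is_deriveVf f x v (df : K) : f x != 0 ->
  is_derive x v f df -> is_derive x v (fun y => (f y)^-1) (- df / f x ^+ 2).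
Proof.
move=> fx0 [d <-]; apply: DeriveDef; first exact: derivableV.
by rewrite deriveV // /GRing.scale /= mulrC mulrN mulNr.
Qed.

Lemma is_deriveXf f n x v (df : K) : is_derive x v f df ->
  is_derive x v (fun y => f y ^+ n) (n%:R * f x ^+ n.-1 * df).
Proof.
move=> dfx; have -> : (fun y => f y ^+ n) = f ^+ n.
  by apply/funext => y; rewrite fctE.
exact: is_deriveX.
Qed.

Lemma is_derive_sumf (I : Type) (r : seq I) (h : I -> V -> K) x v (dh : I -> K) :
  (forall i, is_derive x v (h i) (dh i)) ->
  is_derive x v (fun y => \sum_(i <- r) h i y) (\sum_(i <- r) dh i).
Proof.
move=> H; elim: r => [|i r IH].
  rewrite big_nil; have -> : (fun y => \sum_(i <- [::]) h i y) = cst 0.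
    by apply/funext => y; rewrite big_nil.
  exact: is_derive_cst.
rewrite big_cons; have -> : (fun y => \sum_(j <- i :: r) h j y) =
    h i + (fun y => \sum_(j <- r) h j y).
  by apply/funext => y; rewrite big_cons.
exact: is_deriveD.
Qed.

(** Continuity of the branch suffices: the difference quotient of f is that of its square h divided
    by f (t v + x) + f x, which tends to 2 f x. *)
Lemma is_derive_sqrt f h x v dh : {for x, continuous f} ->
  (\forall y \near x, f y ^+ 2 = h y) -> f x != 0 ->
  is_derive x v h dh -> is_derive x v f (dh / (2 * f x)).
Proof.
move=> fc fh fx0 [hd hv].
have n2 : (2 : K) != 0 by rewrite pnatr_eq0.
have cc : (fun t : K => t *: v + x) @ (0 : K)^' --> x.
  have c0 : (fun t : K => t *: v + x) @ (0 : K) --> x.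
    have := cvgD (@scalel_continuous K V v 0) (cvg_cst x).
    by rewrite scale0r add0r; apply.
  by apply: cvg_trans c0; apply: cvg_fmap2; exact: nbhs_dnbhs.
suff H : (fun t : K => t^-1 *: ((f \o shift x) (t *: v) - f x)) @ 0^' -->
    dh / (2 * f x).
  apply: DeriveDef; first by apply/cvg_ex; exists (dh / (2 * f x)).
  exact: cvg_lim H.
have fcc : (fun t : K => f (t *: v + x)) @ (0 : K)^' --> f x.
  exact: (cvg_comp _ _ cc fc).
have l : (fun t : K => (t^-1 *: ((h \o shift x) (t *: v) - h x)) *
    (f (t *: v + x) + f x)^-1) @ 0^' --> dh / (2 * f x).
  apply: cvgM.
    rewrite -hv; exact: hd.
  apply: cvgV; first by rewrite mulf_neq0.
  by rewrite mulr_natl mulr2n; apply: cvgD => //; exact: cvg_cst.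
apply: cvg_trans l; apply: near_eq_cvg.
have fx : f x ^+ 2 = h x by exact: nbhs_singleton fh.
have n1 : \forall t \near (0 : K)^', f (t *: v + x) ^+ 2 = h (t *: v + x).
  exact: cc fh.
have n3 : \forall t \near (0 : K)^', f (t *: v + x) + f x != 0.
  apply: cvgr_neq0 (cvgD fcc (cvg_cst (f x))) _.
  by rewrite -mulr2n -mulr_natl mulf_neq0.
near=> t.
have e1 : f (t *: v + x) ^+ 2 = h (t *: v + x) by near: t.
have e3 : f (t *: v + x) + f x != 0 by near: t.
by rewrite /= -e1 -fx subr_sqr /GRing.scale /= mulrA mulfK.
Unshelve. all: by end_near. Qed.

Definition fps_derive v F x (dF : fps K) :=
  forall i, is_derive x v (fun y => F y i) (dF i).

Lemma fps_derive_unique v F x dF dG :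
  fps_derive v F x dF -> fps_derive v F x dG -> dF = dG.
Proof.
by move=> dFx dGx; apply/funext => i; exact: is_derive_unique (dFx i) (dGx i).
Qed.

Lemma near_fps_derive v F G x dF : (\forall y \near x, F y = G y) ->
  fps_derive v F x dF -> fps_derive v G x dF.
Proof.
move=> FG dFx i; apply: near_is_derive (dFx i).
by apply: filterS FG => y ->.
Qed.

Lemma fps_deriveM v F G x dF dG :
  fps_derive v F x dF -> fps_derive v G x dG ->
  fps_derive v (fun y => F y * G y) x (dF * G x + F x * dG).
Proof.
move=> dFx dGx i; rewrite fpsD !fpsM -big_split /=.
by apply: is_derive_sumf => j; exact: is_deriveMf.
Qed.

Lemma fps_derive_cst v (f : fps K) x : fps_derive v (fun=> f) x 0.
Proof. by move=> i; exact: is_derive_cst. Qed.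

Lemma fps_deriveCM v (a : fps K) F x dF :
  fps_derive v F x dF -> fps_derive v (fun y => a * F y) x (a * dF).
Proof.
move=> dFx i; have := fps_deriveM (fps_derive_cst v a x) dFx i.
by rewrite mul0r add0r.
Qed.

Lemma fps_derive_prod0 (I : Type) (r : seq I) (P : pred I)
    (H : I -> V -> fps K) v x :
  (forall i, P i -> fps_derive v (H i) x 0) ->
  fps_derive v (fun y => \prod_(i <- r | P i) H i y) x 0.
Proof.
move=> dH; elim: r => [|i r IH].
  under eq_fun do rewrite big_nil.
  exact: fps_derive_cst.
under eq_fun do rewrite big_cons.
have [Pi|//] := boolP (P i).
by have := fps_deriveM (dH i Pi) IH; rewrite mul0r mulr0 addr0.
Qed.

Lemma derivableMf f g x v : derivable f x v -> derivable g x v ->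
  derivable (fun y => f y * g y) x v.
Proof. exact: derivableM. Qed.

Lemma derivable_sumf n (H : 'I_n -> V -> K) x v :
  (forall i, derivable (H i) x v) ->
  derivable (fun y => \sum_(i < n) H i y) x v.
Proof.
by move=> dH; apply: ex_derive; apply: is_derive_sumf => i; exact: derivableP.
Qed.

Lemma near_derivable f g x v :
  (\forall y \near x, f y = g y) -> derivable f x v -> derivable g x v.
Proof. exact: near_eq_derivable. Qed.

(* The coefficients of the solution F of u F = z are determined recursively. *)
Lemma fps_derivable_solve v (u F z : V -> fps K) x :
  (\forall y \near x, u y * F y = z y) -> (\forall y \near x, u y 0 != 0) ->
  (forall i, derivable (u^~ i) x v) -> (forall i, derivable (z^~ i) x v) ->
  forall i, derivable (F^~ i) x v.
Proof.
move=> uFz u0 du dz i; have [n] := ubnP i; elim: n i => // n IH i lt_in.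
apply: (@near_derivable (fun y =>
  (z y i - \sum_(j < i) u y j.+1 * F y (i - j.+1)%N) * (u y 0)^-1)).
  apply: filterS2 uFz u0 => y <- u0; rewrite fpsM big_ord_recl /= subn0.
  by rewrite addrK mulrC mulKf.
apply: derivableMf; last by apply: derivableV => //; exact: nbhs_singleton u0.
apply: derivableB => //; apply: derivable_sumf => j; apply: derivableMf => //.
by apply: IH; case: j => j /= lt_ji; lia.
Qed.

(** Order i + 1 of F * F is 2 F_0 F_(i+1) plus products of earlier coefficients, so
    differentiability propagates upwards from F_0, where it comes from [is_derive_sqrt]. *)
Lemma fps_derivable_sqrt v (F z : V -> fps K) x :
  (\forall y \near x, F y * F y = z y) -> (\forall y \near x, F y 0 != 0) ->
  {for x, continuous (F^~ 0)} -> (forall i, derivable (z^~ i) x v) ->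
  forall i, derivable (F^~ i) x v.
Proof.
move=> FFz F0 cF dz i; have n2 : (2 : K) != 0 by rewrite pnatr_eq0.
have dF0 : derivable (F^~ 0) x v.
  apply: ex_derive; apply: is_derive_sqrt cF _ _ (derivableP (dz 0)).
    by apply: filterS FFz => y <-; rewrite fpsM0 expr2.
  exact: nbhs_singleton F0.
have [n] := ubnP i; elim: n i => // n IH [//|i] lt_in.
apply: (@near_derivable (fun y =>
  (z y i.+1 - \sum_(j < i) F y j.+1 * F y (i - j)%N) * (2 * F y 0)^-1)).
  apply: filterS2 FFz F0 => y <- F0; rewrite fpsM big_ord_recl big_ord_recr /=.
  rewrite subn0 subSS subnn.
  have -> : \sum_(j < i) F y (bump 0 j) * F y (i.+1 - bump 0 j)%N =
            \sum_(j < i) F y j.+1 * F y (i - j)%N by [].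
  by field.
apply: derivableMf; last first.
  apply: derivableV; last by apply: derivableMf => //; exact: derivable_cst.
  by rewrite mulf_neq0 //; exact: nbhs_singleton F0.
apply: derivableB => //; apply: derivable_sumf => j.
by apply: derivableMf; apply: IH; case: j => j /= lt_ji; lia.
Qed.

End Derive.

(** * Taylor series of a square root *)

Lemma deriv_nderivn (R : comNzRingType) (p : {poly R}) n :
  (p^`N(n))^`()%R = p^`N(n.+1) *+ n.+1.
Proof.
apply/polyP => i; rewrite coef_deriv coefMn !coef_nderivn addnS -addSn.
rewrite -!mulrnA; congr (_ *+ _).
by rewrite [RHS]mulnC mul_bin_left addSn subSn ?leq_addr // addKn mulnC.
Qed.

Lemma coef_comp_shift (R : comNzRingType) (p : {poly R}) (a : R) n :
  (p \Po ('X + a%:P))`_n = (p^`N(n)).[a].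
Proof.
rewrite /comp_poly addrC nderiv_taylor; last exact: mulrC.
rewrite (coef_sum _ _ _ n).
have E i : ((map_poly polyC p)^`N(i).[a%:P] * 'X^i)`_n =
    if n == i then (p^`N(i)).[a] else 0.
  by rewrite nderivn_map horner_map /= coefCM coefXn; case: eqP; rewrite ?mulr1 ?mulr0.
under eq_bigr do rewrite E.
have [lt_ns|le_sn] := ltnP n (size (map_poly polyC p)).
  rewrite (bigD1 (Ordinal lt_ns)) //= eqxx big1 ?addr0 // => i ni.
  by rewrite -val_eqE eq_sym /= in ni; rewrite (negPf ni).
rewrite big1 => [|i _]; last by rewrite gtn_eqF // (leq_trans (ltn_ord i)).
rewrite nderivn_poly0 ?horner0 //.
by rewrite size_map_polyC in le_sn.
Qed.

Section Taylor.
Variable K : numFieldType.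
Local Open Scope classical_set_scope.
Local Open Scope ring_scope.
Implicit Types (f : K -> K) (p D : {poly K}) (a t : K).

Lemma is_derive_hornerf (V : normedModType K) (g : V -> K) (x v : V) dg p :
  is_derive x v g dg ->
  is_derive x v (fun y => p.[g y]) ((p^`()%R).[g x] * dg).
Proof.
move=> dgx; elim/poly_ind: p => [|p c IH].
  under eq_fun do rewrite horner0.
  by rewrite deriv0 horner0 mul0r; exact: is_derive_cst.
have -> : (fun y => (p * 'X + c%:P).[g y]) = (fun y => p.[g y] * g y) + cst c.
  by apply/funext => y; rewrite hornerMXaddC.
apply: is_derive_eq (is_deriveD (is_deriveMf IH dgx) (is_derive_cst c x v)) _.
by rewrite derivMXaddC hornerD hornerMX addr0; ring.
Qed.

Lemma is_derive_hornerN p t : is_derive t 1 (horner p) (p^`()%R).[t].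
Proof. by have := is_derive_hornerf p (is_derive_id t 1); rewrite mulr1. Qed.

Lemma derivable_hornerN p t : derivable (horner p) t 1.
Proof. by have [] := is_derive_hornerN p t. Qed.

Lemma continuous_hornerN p : continuous (horner p).
Proof.
move=> t; apply/differentiable_continuous/derivable1_diffP.
exact: derivable_hornerN.
Qed.

Variables (f : K -> K) (D : {poly K}) (a : K).
Hypothesis fa : \forall t \near a, {for t, continuous f} /\ f t ^+ 2 = D.[t].
Hypothesis Da : D.[a] != 0.

Let good t := [/\ {for t, continuous f}, f t ^+ 2 = D.[t] & D.[t] != 0].
(** Asking for [good] on a whole neighbourhood makes [A] an open condition, so that identities valid
    under [A] may be differentiated in t. *)
Let A t := \forall s \near t, good s.

Let Aa : A a.
Proof.
have D0 : \forall t \near a, D.[t] != 0.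
  exact: cvgr_neq0 (@continuous_hornerN D a) Da.
by rewrite /A; apply: filterS2 fa D0 => t [].
Qed.

Let AA t : A t -> \forall s \near t, A s. Proof. exact: near_join. Qed.
Let A1 t : A t -> good t. Proof. exact: nbhs_singleton. Qed.

Let f_neq0 t : A t -> f t != 0.
Proof. by move=> /A1[_ e]; rewrite -e sqrf_eq0. Qed.

Let df t : A t -> is_derive t 1 f ((D^`()%R).[t] / (2 * f t)).
Proof.
move=> At; have [cf _ _] := A1 At.
apply: is_derive_sqrt cf _ (f_neq0 At) (is_derive_hornerN D t).
by apply: filterS At => s [].
Qed.

(* The iterated derivatives are f q / D ^ n with q a polynomial. *)
Let smooth n : exists q : {poly K}, forall t, A t ->
  derive1n n f t = f t * q.[t] / D.[t] ^+ n.
Proof.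
elim: n => [|n [q IH]].
  by exists 1 => t _; rewrite derive1n0 hornerC expr0 divr1 mulr1.
(* Since f' = f D' / (2 D), the derivative of f q / D^n is f (D' q / 2 + q' D - n D' q) /
   D^(n+1). *)
exists (2^-1 *: (D^`()%R * q) + q^`()%R * D - D^`()%R * q *+ n) => t At.
rewrite derive1nS derive1E.
have [_ sq Dt] := A1 At; have ft := f_neq0 At.
have := is_deriveMf (is_deriveMf (df At) (is_derive_hornerN q t))
  (is_deriveVf (f := fun s => D.[s] ^+ n) (expf_neq0 n Dt)
     (is_deriveXf n (is_derive_hornerN D t))).
move=> /(near_is_derive (g := derive1n n f)) [|_ ->].
  by apply: filterS (AA At) => s As; rewrite IH.
have n2 : (2 : K) != 0 by rewrite pnatr_eq0.
rewrite !(hornerE, hornerMn) /GRing.scale /=.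
case: n {IH} => [|n] /=.
  by rewrite expr1 !expr0 mulr0n !mul0r -sq; field; rewrite ft.
have := expf_neq0 n Dt; rewrite -[_ * _ *+ n.+1]mulr_natl !exprS.
move: (D.[t] ^+ n) (n.+1%:R : K) => E N E0; rewrite -sq; field.
by rewrite ft E0.
Qed.

(** [derive1n] is total, so its recursion says nothing about differentiability; that is read off the
    closed form in [smooth]. *)
Let smooth_derive n t : A t -> is_derive t 1 (derive1n n f) (derive1n n.+1 f t).
Proof.
move=> At; have [q qE] := smooth n; rewrite derive1nS derive1E.
apply: derivableP; have [_ _ Dt] := A1 At.
apply: (@near_derivable _ _ (fun t => f t * q.[t] / D.[t] ^+ n)).
  by apply: filterS (AA At) => s As; rewrite qE.
apply: derivableMf.
  by apply: derivableMf; [have [] := df At|exact: derivable_hornerN].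
apply: derivableV; first by rewrite expf_neq0.
by have [] := is_deriveXf n (is_derive_hornerN D t).
Qed.

Let y t : fps K := fun n => n`!%:R^-1 * derive1n n f t.

Let y_derive n t : A t -> is_derive t 1 (fun s => y s n) (n.+1%:R * y t n.+1).
Proof.
move=> At; have := is_deriveMf (is_derive_cst (n`!%:R^-1 : K) t 1)
  (smooth_derive n At).
rewrite mul0r add0r => /is_derive_eq; apply.
by rewrite /y mulrA /cst factS natrM invfM mulrA mulfV ?mul1r.
Qed.

(** On both sides the derivative in t of the term of order n is n + 1 times the term of order n + 1,
    so the identity climbs from order 0, where it is f^2 = D. The induction needs it at all nearby
    t. *)
Let yy n t : A t -> (y t * y t) n = (D^`N(n)).[t].
Proof.
elim: n t => [|n IH] t At.
  rewrite nderivn0 fpsM0 /y derive1n0 fact0 invr1 !mul1r -expr2.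
  by have [] := A1 At.
have d1 : is_derive t 1 (fun s => (y s * y s) n) (D^`N(n.+1).[t] *+ n.+1).
  rewrite -hornerMn -deriv_nderivn.
  apply: near_is_derive (is_derive_hornerN _ t).
  by apply: filterS (AA At) => s As; rewrite IH.
have d2 : is_derive t 1 (fun s => (y s * y s) n) ((y t * y t) n.+1 *+ n.+1).
  have : is_derive t 1 (fun s => (y s * y s) n)
     (\sum_(j < n.+1) (j.+1%:R * y t j.+1 * y t (n - j)%N +
                      y t j * ((n - j).+1%:R * y t (n - j).+1))).
    by apply: is_derive_sumf => j; apply: is_deriveMf; exact: y_derive.
  move/is_derive_eq; apply; rewrite big_split /=.
  (* After reindexing, both halves run over the terms y_j y_(n+1-j), with weights j and n + 1 - j,
     which add up to n + 1. *)
  pose F j := j%:R * y t j * y t (n.+1 - j)%N.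
  have -> : \sum_(j < n.+1) j.+1%:R * y t j.+1 * y t (n - j)%N =
      \sum_(j < n.+2) j%:R * y t j * y t (n.+1 - j)%N.
    by rewrite [RHS]big_ord_recl /= !mul0r add0r.
  have -> : \sum_(j < n.+1) y t j * ((n - j).+1%:R * y t (n - j).+1) =
      \sum_(j < n.+2) (n.+1 - j)%:R * y t j * y t (n.+1 - j)%N.
    rewrite [RHS]big_ord_recr /= subnn !mul0r addr0; apply: eq_bigr => j _.
    by rewrite subSn; [rewrite mulrCA mulrA|rewrite -ltnS].
  rewrite -big_split fpsM -mulr_natl mulr_sumr; apply: eq_bigr => j _ /=.
  by rewrite -!mulrDl -natrD subnKC ?mulrA // -ltnS.
by have /eqP := is_derive_unique d2 d1; rewrite eqrMn2r => /eqP.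
Qed.

Lemma taylor_sqrt : y a * y a = fps_poly (D \Po ('X + a%:P)).
Proof.
by apply/funext => n; rewrite yy // /fps_poly coef_comp_shift.
Qed.

End Taylor.

(** * Dependence of the series on the eigenvalues *)

Section PairContinuous.
Variables S T : topologicalType.
Local Open Scope classical_set_scope.

Lemma cvg_pairl (x : S) (t : T) : (fun t => (x, t)) @ t --> (x, t).
Proof.
by apply: (@cvg_pair _ _ _ _ (nbhs x) (nbhs t)); [exact: cvg_cst|exact: cvg_id].
Qed.

Lemma cvg_pairr (x : S) (t : T) : (fun x => (x, t)) @ x --> (x, t).
Proof.
by apply: (@cvg_pair _ _ _ _ (nbhs x) (nbhs t)); [exact: cvg_id|exact: cvg_cst].
Qed.

End PairContinuous.

Section Branch.
Variables (K : numFieldType) (n : nat).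
Local Open Scope classical_set_scope.
Local Open Scope ring_scope.
Implicit Types (x y : 'rV[K]_n) (s i j : 'I_n).

Lemma is_derive_coord x j s :
  is_derive x (delta_mx 0 j) (fun y => y 0 s) (s == j)%:R.
Proof.
suff H : (fun t : K => t^-1 *: (((fun y => y 0 s) \o shift x)
    (t *: delta_mx 0 j) - x 0 s)) @ 0^' --> ((s == j)%:R : K).
  apply: DeriveDef; first by apply/cvg_ex; exists (s == j)%:R.
  exact: cvg_lim H.
have l : (fun=> (s == j)%:R : K) @ (0 : K)^' --> ((s == j)%:R : K).
  exact: cvg_cst.
apply: cvg_trans l.
apply: near_eq_cvg; near=> t.
have t0 : t != 0 by near: t; exact: nbhs_dnbhs_neq.
by rewrite /= !mxE eqxx addrK /GRing.scale /= mulKf.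
Unshelve. all: by end_near. Qed.

Variables (p q : {poly K}) (a : K) (U : set 'rV[K]_n) (sig : 'rV[K]_n -> K -> K).

Definition tser x : fps K := fun k : nat => k`!%:R^-1 * derive1n k (sig x) a.
Definition pser := fps_poly (p \Po ('X + a%:P)).
Definition qser := fps_poly (q \Po ('X + a%:P)).
Definition fser s x : fps K := pser - fpsC (x 0 s) * qser.

Hypothesis Uo : open U.
Hypothesis sigP : forall x, U x -> \forall z \near (x, a),
  {for z, continuous (fun w : 'rV[K]_n * K => sig w.1 w.2)} /\
  sig z.1 z.2 ^+ 2 = (\prod_s (p - z.1 0 s *: q)).[z.2].
Hypothesis pq_neq0 : forall x, U x -> forall s, p.[a] - x 0 s * q.[a] != 0.

Let nearU x : U x -> \forall y \near x, U y.
Proof. by move=> Ux; exact: open_nbhs_nbhs. Qed.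

Lemma fserE s x : fser s x = fps_poly ((p - x 0 s *: q) \Po ('X + a%:P)).
Proof. by rewrite /fser /fpsC -rmorphM -rmorphB /= comp_polyB comp_polyZ mul_polyC. Qed.

Lemma fser0 s x : fser s x 0 = p.[a] - x 0 s * q.[a].
Proof.
rewrite fserE /fps_poly coef_comp_shift nderivn0.
by rewrite !hornerE.
Qed.

Lemma tser_sqr x : U x -> tser x * tser x = \prod_s fser s x.
Proof.
move=> Ux; rewrite (eq_bigr _ (fun s _ => fserE s x)) -rmorph_prod.
rewrite -(rmorph_prod (comp_poly _)) /=.
apply: taylor_sqrt; last first.
  rewrite horner_prod; apply/prodf_neq0 => s _.
  by have := pq_neq0 Ux s; rewrite !hornerE.
have c (t : K) : (fun t : K => (x, t) : 'rV[K]_n * K) @ t --> (x, t).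
  exact: cvg_pairl.
have H : \forall t \near a,
    {for (x, t), continuous (fun w : 'rV[K]_n * K => sig w.1 w.2)} /\
    sig x t ^+ 2 = (\prod_s (p - x 0 s *: q)).[t] by exact: c a _ (sigP Ux).
apply: filterS H => t [cs e]; split=> //.
exact: (cvg_comp _ _ (c t) cs).
Qed.

Lemma tser0_neq0 x : U x -> tser x 0 != 0.
Proof.
move=> Ux; have : (tser x * tser x) 0 != 0.
  rewrite tser_sqr // (eq_bigr _ (fun s _ => fserE s x)) -rmorph_prod.
  rewrite -(rmorph_prod (comp_poly _)) /= /fps_poly coef_comp_shift nderivn0.
  rewrite horner_prod; apply/prodf_neq0 => s _.
  by have := pq_neq0 Ux s; rewrite !hornerE.
by rewrite fpsM0 mulf_eq0 negb_or => /andP[].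
Qed.

(** The constant terms do not vanish on [U]; [choice] makes the inverses functions of x, so that
    they can be differentiated. *)
Lemma fser_inv : exists e : 'I_n -> 'rV[K]_n -> fps K,
  forall x, U x -> forall s, fser s x * e s x = 1.
Proof.
have H (z : 'I_n * 'rV[K]_n) : exists g, U z.2 -> fser z.1 z.2 * g = 1.
  have [Ux|] := pselect (U z.2); last by exists 0.
  have [|g gP] := @fps_inv _ (fser z.1 z.2) (fser z.1 z.2 0)^-1; last by exists g.
  by rewrite mulfV // fser0 pq_neq0.
have [e eP] := choice H.
by exists (fun s x => e (s, x)) => x Ux s; exact: (eP (s, x) Ux).
Qed.

Variable e : 'I_n -> 'rV[K]_n -> fps K.
Hypothesis fserK : forall x, U x -> forall s, fser s x * e s x = 1.

Lemma fser_derive x s j :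
  fps_derive (delta_mx 0 j) (fser s) x (if s == j then - qser else 0).
Proof.
move=> i; rewrite /fser.
have -> : (if s == j then - qser else 0) i = 0 - (s == j)%:R * qser i.
  by case: eqP => _; rewrite ?mul1r ?mul0r ?sub0r ?subr0 // oppr0.
have -> : (fun y => (pser - fpsC (y 0 s) * qser) i) =
    cst (pser i) - (fun y => y 0 s * qser i).
  by apply/funext => y; rewrite fpsD fpsN fpsCM.
apply: is_deriveB.
have := is_deriveMf (is_derive_coord x j s) (is_derive_cst (qser i) x (delta_mx 0 j)).
by rewrite mulr0 addr0.
Qed.

(** Solving [fser] * [e] = 1 order by order gives differentiability; the value then follows by
    differentiating this identity. *)
Lemma inv_derive x i j : U x -> fps_derive (delta_mx 0 j) (e i) x
  (if i == j then qser * e i x ^+ 2 else 0).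
Proof.
move=> Ux.
have de k : derivable ((e i)^~ k) x (delta_mx 0 j).
  apply: (@fps_derivable_solve _ _ _ (fser i) (e i) (fun=> 1)) => [|||k'].
  - by apply: filterS (nearU Ux) => y Uy; exact: fserK.
  - by apply: filterS (nearU Ux) => y Uy; rewrite fser0 pq_neq0.
  - by move=> k'; have [] := @fser_derive x i j k'.
  - exact: derivable_cst.
pose d : fps K := fun k => 'D_(delta_mx 0 j) ((e i)^~ k) x.
have dP : fps_derive (delta_mx 0 j) (e i) x d.
  by move=> k; exact/derivableP.
have d1 := fps_deriveM (@fser_derive x i j) dP.
have d2 : fps_derive (delta_mx 0 j) (fun y => fser i y * e i y) x 0.
  apply: near_fps_derive (fps_derive_cst (delta_mx 0 j) 1 x).
  by apply: filterS (nearU Ux) => y Uy; rewrite fserK.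
have E : (if i == j then - qser else 0) * e i x + fser i x * d = 0.
  exact: fps_derive_unique d1 d2.
suff <- : d = (if i == j then qser * e i x ^+ 2 else 0) by [].
rewrite -[d]mul1r -(fserK Ux i) mulrAC -(addrK ((if i == j then - qser else 0) * e i x) (fser i x * d)).
rewrite [fser i x * d + _]addrC E sub0r.
by case: eqP => _; ring.
Qed.

Let h : fps K := fpsC 2^-1.
Let hh : h + h = 1.
Proof.
rewrite /h -rmorphD /= (_ : 2^-1 + 2^-1 = 1 :> K); last by field.
exact: rmorph1.
Qed.

Lemma tser_inv x : U x -> tser x * (tser x * \prod_s e s x) = 1.
Proof.
move=> Ux; rewrite mulrA tser_sqr // -big_split big1 // => s _.
exact: fserK.
Qed.

Lemma tser_derive x j : U x -> fps_derive (delta_mx 0 j) tser x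
  (- (h * qser * tser x * e j x)).
Proof.
move=> Ux.
have dz : fps_derive (delta_mx 0 j) (fun y => \prod_s fser s y) x
    (- qser * \prod_(s | s != j) fser s x).
  have d1 := @fser_derive x j j.
  have d2 := @fps_derive_prod0 _ _ _ (index_enum 'I_n) (fun s => s != j)
    fser (delta_mx 0 j) x.
  have := fps_deriveM d1 (d2 _); rewrite eqxx mulr0 addr0.
  have -> : (fun y => \prod_s fser s y) =
      (fun y => fser j y * \prod_(s | s != j) fser s y).
    by apply/funext => y; rewrite (bigD1 j).
  by apply =>  s sj; have := @fser_derive x s j; rewrite (negPf sj).
have nsq : \forall y \near x, tser y * tser y = \prod_s fser s y.
  by apply: filterS (nearU Ux) => y Uy; rewrite tser_sqr.
have dt k : derivable (tser^~ k) x (delta_mx 0 j).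
  apply: fps_derivable_sqrt nsq _ _ _ k.
  - by apply: filterS (nearU Ux) => y Uy; exact: tser0_neq0.
  - have [cs _] := nbhs_singleton (sigP Ux).
    have H : (fun y => sig y a) @ x --> sig x a.
      exact: (cvg_comp _ _ (@cvg_pairr _ _ x a) cs).
    have E : tser^~ 0 = (fun y => sig y a).
      by apply/funext => y; rewrite /tser fact0 invr1 mul1r derive1n0.
    change (tser^~ 0 @ x --> (tser^~ 0) x).
    by rewrite E.
  - by move=> k; have [] := dz k.
pose d : fps K := fun k => 'D_(delta_mx 0 j) (tser^~ k) x.
have dP : fps_derive (delta_mx 0 j) tser x d by move=> k; exact/derivableP.
have E : d * tser x + tser x * d = - qser * \prod_(s | s != j) fser s x.
  exact: fps_derive_unique (near_fps_derive nsq (fps_deriveM dP dP)) dz.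
(* Dropping the factor j from the square of [tser] amounts to multiplying by its inverse. Together
   with [hh] and [tser_inv] this solves [E] for [d]. *)
have E2 : \prod_(s | s != j) fser s x = tser x * tser x * e j x.
  by rewrite tser_sqr // [in RHS](bigD1 j) //= mulrAC fserK // mul1r.
suff <- : d = - (h * qser * tser x * e j x) by [].
have : tser x * d = tser x * (- (h * qser * tser x * e j x)).
  transitivity ((h + h) * (tser x * d)); first by rewrite hh mul1r.
  transitivity (h * (d * tser x + tser x * d)); first by ring.
  by rewrite E E2; ring.
move/(congr1 ( *%R (tser x * \prod_s e s x))).
by rewrite !mulrA -!(mulrC (tser x)) !mulrA -(mulrA (tser x)) tser_inv // !mul1r.
Qed.

Lemma tser_derive2 x i j : U x ->
  fps_derive (delta_mx 0 j) (fun y => - (h * qser * tser y * e i y)) x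
    (if i == j then - (h ^+ 2 * qser ^+ 2 * tser x * e i x ^+ 2)
     else h ^+ 2 * qser ^+ 2 * tser x * e i x * e j x).
Proof.
move=> Ux.
have H := fps_deriveCM (- (h * qser))
  (fps_deriveM (@tser_derive x j Ux) (@inv_derive x i j Ux)).
have -> : (fun y => - (h * qser * tser y * e i y)) =
    (fun y => - (h * qser) * (tser y * e i y)).
  by apply/funext => y; ring.
set D := (X in fps_derive _ _ _ X).
suff -> : D = - (h * qser) * (- (h * qser * tser x * e j x) * e i x +
   tser x * (if i == j then qser * e i x ^+ 2 else 0)).
  exact: H.
rewrite /D; case: eqP => [->|_]; last by ring.
(* On the diagonal the derivative of [tser] contributes h^2 and that of [e j] contributes - h = - 2
   h^2, leaving - h^2. *)
rewrite -[qser * e j x ^+ 2]mul1r -hh; ring.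
Qed.

End Branch.

(** * Partial fractions *)

Lemma is_derive_prodf (K : numFieldType) (V : normedModType K) (I : Type)
    (r : seq I) (P : pred I) (h : I -> V -> K) (x v : V) (dh : I -> K) :
  (forall i, P i -> is_derive x v (h i) (dh i)) ->
  (forall i, P i -> h i x != 0) ->
  is_derive x v (fun y => \prod_(i <- r | P i) h i y)
    ((\prod_(i <- r | P i) h i x) * \sum_(i <- r | P i) dh i / h i x).
Proof.
move=> dhx hx0; elim: r => [|i r IH].
  rewrite !big_nil mulr0; under eq_fun do rewrite big_nil.
  exact: is_derive_cst.
under eq_fun do rewrite big_cons.
rewrite !big_cons; have [Pi|//] := boolP (P i).
apply: is_derive_eq (is_deriveMf (dhx i Pi) IH) _.
by field; exact: hx0.
Qed.

(** In characteristic zero the numbers 0, 1, ... below the size of p are distinct, hence too many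
    roots. *)
Lemma poly_eq0_horner (K : numFieldType) (p : {poly K}) :
  (forall t, p.[t] = 0) -> p = 0.
Proof.
move=> p0; apply: (@roots_geq_poly_eq0 _ _ [seq i%:R | i <- iota 0 (size p)]).
- by apply/allP => t _; apply/eqP; exact: p0.
- rewrite map_inj_uniq ?iota_uniq // => i j /eqP.
  by rewrite eqr_nat => /eqP.
- by rewrite size_map size_iota.
Qed.

Section PartialFractions.
Variables (K : numFieldType) (n : nat) (x : 'I_n -> K).
Hypothesis x_inj : injective x.
Implicit Types (P : {poly K}) (s i j : 'I_n).

Definition vdm s : K := \prod_(j | j != s) (x s - x j).

Lemma vdm_neq0 s : vdm s != 0.
Proof.
by apply/prodf_neq0 => j js; rewrite subr_eq0 (inj_eq x_inj) eq_sym.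
Qed.

(** The residue of P / prod_j (X - x_j) at x_s, and at the same time the entry g^ss of the metric:
    this coincidence ties the metric to partial fractions. *)
Definition residue P s : K := P.[x s] / vdm s.

(** Lagrange interpolation with one degree to spare: the difference of the two sides has degree
    below n, because the top coefficients agree, and it vanishes at the n points x_s. *)
Lemma partial_fractions P : (size P <= n.+1)%N ->
  P = P`_n *: \prod_j ('X - (x j)%:P) +
      \sum_s residue P s *: \prod_(j | j != s) ('X - (x j)%:P).
Proof.
move=> sP; set W := \prod_j _; set S := \sum_s _.
have sW : size W = n.+1.
  by rewrite /W size_prod_XsubC -[index_enum _]enumT size_enum_ord.
have mW : W`_n = 1.
  by have /monicP := monic_prod_XsubC (index_enum 'I_n) predT x; rewrite lead_coefE -/W sW.
pose Q s := \prod_(j | j != s) ('X - (x j)%:P).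
have WQ s : W = ('X - (x s)%:P) * Q s by rewrite /W (bigD1 s).
have sQ s : size (Q s) = n.
  have := sW; rewrite (WQ s) size_Mmonic ?monic_prod_XsubC ?polyXsubC_eq0 //.
  by rewrite size_XsubC => -[].
have sS : (size S <= n)%N.
  apply: (leq_trans (size_sum _ _ _)); apply/bigmax_leqP => s _.
  by apply: leq_trans (size_scale_leq _ _) _; rewrite -/(Q s) sQ.
apply/eqP; rewrite -subr_eq0 opprD addrA; apply/eqP.
apply: (@roots_geq_poly_eq0 _ _ [seq x s | s <- enum 'I_n]).
- apply/allP => _ /mapP[s _ ->]; apply/eqP.
  rewrite !(hornerD, hornerN, hornerZ) (WQ s) hornerM hornerXsubC subrr mul0r.
  rewrite mulr0 subr0 /S horner_sum (bigD1 s) //= [X in _ - (_ + X)]big1 => [|j js].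
    rewrite hornerZ horner_prod (eq_bigr (fun j => x s - x j)) => [|j _].
      by rewrite addr0 -/(vdm s) divfK ?vdm_neq0 // subrr.
    by rewrite hornerXsubC.
  by rewrite hornerZ horner_prod (bigD1 s) 1?eq_sym //= hornerXsubC subrr mul0r mulr0.
- by rewrite map_inj_uniq ?enum_uniq.
- rewrite size_map size_enum_ord; apply/leq_sizeP => j.
  rewrite leq_eqVlt => /orP[/eqP <-|lt_nj].
    rewrite !(coefD, coefN, coefZ) mW mulr1 subrr sub0r.
    by rewrite (leq_sizeP _ _ sS) ?oppr0.
  rewrite !(coefD, coefN, coefZ) !(leq_sizeP _ _ _ _ lt_nj) ?(leq_trans sS) ?sW //.
  by rewrite mulr0 !subr0.
Qed.

(** This serves to rewrite the logarithmic derivative of g_ii, which contains P'(x_i), in terms of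
    the residues alone. *)
Lemma deriv_partial_fractions P i : (size P <= n.+1)%N ->
  (P^`()).[x i] = vdm i * (P`_n + \sum_(s | s != i) residue P s / (x i - x s) +
                           residue P i * \sum_(j | j != i) (x i - x j)^-1).
Proof.
move=> sP; pose Q s := \prod_(j | j != s) ('X - (x j)%:P).
have dQ s : s != i -> (Q s)^`().[x i] = vdm i / (x i - x s).
  move=> si; rewrite /Q (bigD1 i) 1?eq_sym //= derivM hornerD !hornerM.
  rewrite derivXsubC hornerC hornerXsubC subrr mul0r addr0 mul1r horner_prod.
  rewrite /vdm [in RHS](bigD1 s) //= mulrAC divff ?subr_eq0 ?(inj_eq x_inj) 1?eq_sym //.
  rewrite mul1r; apply: eq_big => [j|j _]; first by rewrite andbC.
  by rewrite hornerXsubC.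
have Qi : (Q i).[x i] = vdm i.
  by rewrite /Q horner_prod; apply: eq_bigr => j _; rewrite hornerXsubC.
have dQi : (Q i)^`().[x i] = vdm i * \sum_(j | j != i) (x i - x j)^-1.
  have d1 := is_derive_hornerN (Q i) (x i).
  have d2 : is_derive (x i) 1 (fun y => \prod_(j | j != i) (y - x j))
      (vdm i * \sum_(j | j != i) 1 / (x i - x j)).
    apply: is_derive_prodf => j ji; last first.
      by rewrite subr_eq0 (inj_eq x_inj) eq_sym.
    by have := is_deriveB (is_derive_id (x i) 1) (is_derive_cst (x j) (x i) 1);
      rewrite subr0.
  have E : horner (Q i) = (fun y => \prod_(j | j != i) (y - x j)).
    apply/funext => y; rewrite /Q horner_prod.
    by apply: eq_bigr => j _; rewrite hornerXsubC.
  rewrite E in d1; rewrite (is_derive_unique d1 d2).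
  by congr (_ * _); apply: eq_bigr => j _; rewrite div1r.
have dW : (\prod_j ('X - (x j)%:P))^`().[x i] = vdm i.
  rewrite (bigD1 i) //= -/(Q i) derivM hornerD !hornerM Qi.
  by rewrite derivXsubC hornerC hornerXsubC subrr mul0r addr0 mul1r.
rewrite {1}(partial_fractions sP) derivD derivZ hornerD hornerZ dW.
rewrite raddf_sum /= horner_sum (bigD1 i) //= derivZ hornerZ -/(Q i) dQi.
have -> : \sum_(s | s != i) (residue P s *: Q s)^`().[x i] =
    vdm i * \sum_(s | s != i) residue P s / (x i - x s).
  rewrite mulr_sumr; apply: eq_bigr => s si.
  by rewrite derivZ hornerZ dQ // mulrCA.
by ring.
Qed.

End PartialFractions.

Section Homogeneous.
Variables (K : numFieldType) (n m : nat) (x : 'I_n -> K).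
Variables (k : 'I_m -> nat) (mu : 'I_m -> K) (c : K).
Hypothesis x_inj : injective x.
Hypothesis le_k : (\sum_i k i <= n)%N.

Definition prootsP : {poly K} := c *: \prod_i ('X - (mu i)%:P) ^+ k i.

(* q^n P(p/q) *)
Definition homP (p q : {poly K}) : {poly K} :=
  c *: (q ^+ (n - \sum_i k i) * \prod_i (p - mu i *: q) ^+ k i).

Lemma size_prootsP : (size prootsP <= n.+1)%N.
Proof.
apply: leq_trans (size_scale_leq _ _) _.
have : forall r : seq 'I_m,
    (size (\prod_(i <- r) ('X - (mu i)%:P) ^+ k i)%R <= (\sum_(i <- r) k i).+1)%N.
  elim=> [|i r IH]; first by rewrite !big_nil size_poly1.
  rewrite !big_cons; apply: leq_trans (size_polyMleq _ _) _.
  by rewrite size_exp_XsubC; lia.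
by move=> /(_ (index_enum _)) H; apply: leq_trans H _; rewrite ltnS.
Qed.

(** Partial fractions at z = p / q, multiplied by q^n. The extra q on the right makes up for the
    omitted factor p - x_s q. *)
Lemma homP_partial_fractions (p q : {poly K}) : q != 0 ->
  homP p q - prootsP`_n *: \prod_j (p - x j *: q) =
  \sum_s residue x prootsP s *: (q * \prod_(j | j != s) (p - x j *: q)).
Proof.
(* With one more factor q, points where q vanishes are trivial; at all others z is defined. *)
move=> q0; apply: (mulfI q0); apply/eqP; rewrite -subr_eq0; apply/eqP.
apply: poly_eq0_horner => t; rewrite hornerD hornerN !hornerM -mulrBr.
have [->|qt0] := eqVneq q.[t] 0; first by rewrite mul0r.
apply/eqP; rewrite mulf_eq0 (negPf qt0) /=.
set z := p.[t] / q.[t].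
have pz a : (p - a *: q).[t] = q.[t] * (z - a).
  by rewrite !hornerE /z mulrBr mulrCA divff // mulr1 [a * _]mulrC.
have hz : (homP p q).[t] = q.[t] ^+ n * prootsP.[z].
  rewrite /homP /prootsP !hornerE !horner_prod.
  rewrite (eq_bigr (fun i => q.[t] ^+ k i * (z - mu i) ^+ k i)) => [|i _]; last first.
    by rewrite horner_exp pz exprMn.
  rewrite big_split /= prodrXr mulrA -(mulrA c) -exprD subnK // (mulrC c).
  by congr (_ * _); apply: eq_bigr => i _; rewrite horner_exp hornerXsubC.
have wz : (\prod_j (p - x j *: q)).[t] = q.[t] ^+ n * \prod_j (z - x j).
  rewrite horner_prod (eq_bigr (fun j => q.[t] * (z - x j))) => [|j _] //.
  by rewrite big_split /= prodr_const card_ord.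
have vz s : (q * \prod_(j | j != s) (p - x j *: q)).[t] =
    q.[t] ^+ n * \prod_(j | j != s) (z - x j).
  rewrite hornerM horner_prod (eq_bigr (fun j => q.[t] * (z - x j))) => [|j _] //.
  rewrite big_split /= prodr_const mulrA -exprS; congr (_ ^+ _ * _).
  by rewrite (cardC1 s) card_ord prednK // (leq_ltn_trans _ (ltn_ord s)).
rewrite hornerD hornerN hz [(_`_n *: _).[t]]hornerZ wz horner_sum.
have -> : \sum_s (residue x prootsP s *:
      (q * \prod_(j | j != s) (p - x j *: q))).[t] =
    \sum_s residue x prootsP s * (q.[t] ^+ n * \prod_(j | j != s) (z - x j)).
  by apply: eq_bigr => s _; rewrite hornerZ vz.
rewrite {1}(partial_fractions x_inj size_prootsP) hornerD hornerZ horner_prod.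
rewrite horner_sum mulrDr mulrCA.
rewrite (eq_bigr (fun j => z - x j)) => [|j _]; last by rewrite hornerXsubC.
rewrite [X in X - _ == 0]addrAC subrr add0r subr_eq0 mulr_sumr; apply/eqP; apply: eq_bigr => s _.
rewrite hornerZ mulrCA horner_prod; congr (_ * (_ * _)).
by apply: eq_bigr => j _; rewrite hornerXsubC.
Qed.

End Homogeneous.

(** * Hessian and Gram identities for series *)

Section Series.
Variables (K : numFieldType) (n : nat) (x : 'I_n -> K) (w : 'I_n -> K) (lead : K).
Hypothesis x_inj : injective x.
Hypothesis w_neq0 : forall s, w s != 0.
Implicit Types (p q Y Ph M : fps K) (e : 'I_n -> fps K) (i j s : 'I_n).

Let h : fps K := fpsC 2^-1.

Definition dser q Y e s : fps K := - (h * q * Y * e s).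

(** Here [e s] stands for 1 / (p - x_s q) and [w s] for g^ss. In the application [lead] is the
    coefficient of degree n of P, nonzero only if d = 0. *)
Definition pf_identity q Ph e :=
  Ph * \prod_s e s = fpsC lead + \sum_s fpsC (w s) * (q * e s).

Definition inv_identity p q e := forall s, (p - fpsC (x s) * q) * e s = 1.

(** The resolvent identity. *)
Lemma invB p q e i j : inv_identity p q e ->
  e i - e j = fpsC (x i - x j) * (q * e i * e j).
Proof.
move=> ue; have -> : e i - e j = ((p - fpsC (x j) * q) * e j) * e i -
    ((p - fpsC (x i) * q) * e i) * e j by rewrite !ue !mul1r.
by rewrite rmorphB; ring.
Qed.

(** By the resolvent identity e_i - e_j has a factor x_i - x_j, which cancels the denominator of the
    Christoffel symbol. *)
Lemma hess_off_series p q Y e i j : inv_identity p q e -> i != j ->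
  h ^+ 2 * q ^+ 2 * Y * e i * e j +
  fpsC (2^-1 / (x i - x j)) * (dser q Y e i - dser q Y e j) = 0.
Proof.
move=> ue ij; have xij : x i - x j != 0 by rewrite subr_eq0 (inj_eq x_inj).
have -> : dser q Y e i - dser q Y e j = - (h * q * Y * (e i - e j)).
  by rewrite /dser; ring.
rewrite (invB i j ue) rmorphM /= -/h.
have E : fpsC (x i - x j)^-1 * fpsC (x i - x j) = 1.
  by rewrite -rmorphM /= mulVf // rmorph1.
transitivity (h ^+ 2 * q ^+ 2 * Y * e i * e j *
   (1 - fpsC (x i - x j)^-1 * fpsC (x i - x j))); first by ring.
by rewrite E subrr mulr0.
Qed.

(* The coefficient L of [dser i] is the logarithmic derivative of g_ii in x_i. *)
Lemma hess_diag_series p q Y Ph e i L : inv_identity p q e ->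
  pf_identity q Ph e ->
  L = - (lead + \sum_(s | s != i) w s / (x i - x s)) / w i ->
  - (h ^+ 2 * q ^+ 2 * Y * e i ^+ 2) - fpsC (2^-1 * L) * dser q Y e i
  - \sum_(s | s != i) fpsC (2^-1 * (w s / w i / (x i - x s))) * dser q Y e s =
  - (fpsC (w i)^-1 * h ^+ 2 * (Y * \prod_s e s) * e i) * (q * Ph).
Proof.
move=> ue pf ->.
have wV : fpsC (w i)^-1 * fpsC (w i) = 1 by rewrite -rmorphM /= mulVf // rmorph1.
(* Multiplying the partial fractions by [e i] and splitting each q e_s e_i by the resolvent identity
   reproduces exactly the Christoffel coefficients w_s / (x_i - x_s). *)
have pfi : Ph * (\prod_s e s) * e i = fpsC lead * e i +
    fpsC (w i) * (q * e i) * e i +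
    \sum_(s | s != i) fpsC (w s / (x i - x s)) * (e i - e s).
  rewrite pf (bigD1 i) //= mulrDl mulrDl addrA; congr (_ + _).
  rewrite mulr_suml; apply: eq_bigr => s si.
  have xis : x i - x s != 0 by rewrite subr_eq0 (inj_eq x_inj) eq_sym.
  by rewrite (invB i s ue) [in RHS]mulrA -rmorphM /= divfK //; ring.
transitivity (- (h ^+ 2 * q * Y * fpsC (w i)^-1 * (Ph * (\prod_s e s) * e i)));
  last by ring.
rewrite pfi.
have -> : \sum_(s | s != i) fpsC (w s / (x i - x s)) * (e i - e s) =
    fpsC (\sum_(s | s != i) w s / (x i - x s)) * e i -
    \sum_(s | s != i) fpsC (w s / (x i - x s)) * e s.
  by rewrite rmorph_sum mulr_suml -sumrB; apply: eq_bigr => s _; rewrite mulrBr.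
have -> : \sum_(s | s != i) fpsC (2^-1 * (w s / w i / (x i - x s))) * dser q Y e s =
    - (h ^+ 2 * q * Y * fpsC (w i)^-1 *
       \sum_(s | s != i) fpsC (w s / (x i - x s)) * e s).
  rewrite -mulNr mulr_sumr; apply: eq_bigr => s _.
  by rewrite mulrAC !rmorphM /= -/h /dser; ring.
rewrite !rmorphM /= rmorphN rmorphD /= -/h /dser.
set S := fpsC (\sum_(s | _) _); set S' := \sum_(s | _) _.
transitivity (- (h ^+ 2 * q ^+ 2 * Y * e i ^+ 2) * (fpsC (w i)^-1 * fpsC (w i))
   - h * (- (fpsC lead + S) * fpsC (w i)^-1) * - (h * q * Y * e i)
   - - (h ^+ 2 * q * Y * fpsC (w i)^-1 * S')); first by rewrite wV mulr1.
by ring.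
Qed.

(** Generating function of the values of g* on the differentials of the coefficients of Y(tau) and
    Y'(upsilon). *)
Definition gram_series q Y e q' Y' e' : fps (fps K) :=
  \sum_s finl (fpsC (w s)) * (finl (dser q Y e s) * finr (dser q' Y' e' s)).

Lemma gram_seriesE q Y e q' Y' e' a b : gram_series q Y e q' Y' e' b a =
  \sum_s w s * dser q Y e s a * dser q' Y' e' s b.
Proof.
rewrite /gram_series fps_sum fps_sum; apply: eq_bigr => s _.
by rewrite mulrA -rmorphM /= finlr_coef fpsCM.
Qed.

(** In the application [Y * \prod_s e s] is 1 / Y. *)
Lemma gram_series_mul p q Y Ph e p' q' Y' Ph' e' :
  inv_identity p q e -> pf_identity q Ph e ->
  inv_identity p' q' e' -> pf_identity q' Ph' e' ->
  (finl p * finr q' - finl q * finr p') * gram_series q Y e q' Y' e' =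
  finl h ^+ 2 * (finl (q * Y) * finr (q' * Ph' * (Y' * \prod_s e' s)) -
                 finl (q * Ph * (Y * \prod_s e s)) * finr (q' * Y')).
Proof.
move=> ue pf ue' pf'.
have hl : finr h = finl h by rewrite /h finlC.
(* Write p q' - q p' = (p - x_s q) q' - (p' - x_s q') q. The sum over s then splits into two
   one-variable partial fractions, in whose difference [lead] cancels. *)
have key s : (finl p * finr q' - finl q * finr p') * (finl (e s) * finr (e' s)) =
    finr (q' * e' s) - finl (q * e s).
  have ul : (finl p - finl (fpsC (x s)) * finl q) * finl (e s) = 1.
    by rewrite -!rmorphM -rmorphB -rmorphM ue rmorph1.
  have ur : (finr p' - finl (fpsC (x s)) * finr q') * finr (e' s) = 1.
    by rewrite finlC -!rmorphM -rmorphB -rmorphM ue' rmorph1.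
  rewrite !rmorphM /=.
  transitivity (((finl p - finl (fpsC (x s)) * finl q) * finl (e s)) *
     (finr q' * finr (e' s)) - ((finr p' - finl (fpsC (x s)) * finr q') * finr (e' s))
      * (finl q * finl (e s))); first by ring.
  by rewrite ul ur !mul1r.
rewrite /gram_series mulr_sumr.
transitivity (\sum_s finl h ^+ 2 * finl (q * Y) * finr (q' * Y') *
   (finl (fpsC (w s)) * finr (q' * e' s) - finl (fpsC (w s)) * finl (q * e s))).
  apply: eq_bigr => s _; rewrite -mulrBr -key /dser !rmorphN !rmorphM /= hl.
  by ring.
rewrite -mulr_sumr sumrB.
have -> : \sum_s finl (fpsC (w s)) * finl (q * e s) =
    finl (Ph * \prod_s e s) - finl (fpsC lead).
  rewrite pf rmorphD /= addrAC subrr add0r rmorph_sum /=.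
  by apply: eq_bigr => s _; rewrite [in RHS]rmorphM.
have -> : \sum_s finl (fpsC (w s)) * finr (q' * e' s) =
    finr (Ph' * \prod_s e' s) - finl (fpsC lead).
  rewrite pf' rmorphD /= -finlC addrAC subrr add0r rmorph_sum /=.
  by apply: eq_bigr => s _; rewrite [in RHS]rmorphM /= finlC.
rewrite !rmorphM /=; ring.
Qed.

(** The factor p q' - q p' is invertible, and each term of [gram_series_mul] is divisible by tau^k
    or by upsilon^k'. *)
Lemma gram_distinct p q Y Ph e p' q' Y' Ph' e' k M k' M' a b :
  inv_identity p q e -> pf_identity q Ph e ->
  inv_identity p' q' e' -> pf_identity q' Ph' e' ->
  q * Ph = fpsX ^+ k * M -> q' * Ph' = fpsX ^+ k' * M' ->
  p 0 * q' 0 - q 0 * p' 0 != 0 -> (a < k)%N -> (b < k')%N ->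
  gram_series q Y e q' Y' e' b a = 0.
Proof.
move=> ue pf ue' pf' qPh qPh' w0 lt_ak lt_bk'.
set W := finl p * finr q' - finl q * finr p'.
have W00 : W 0 0 = p 0 * q' 0 - q 0 * p' 0.
  by rewrite /W !fpsD !fpsN !finlr_coef.
(* Inversion happens twice: first for [W 0], a series in tau, then for [W], a series in upsilon over
   such series. *)
have [|W0' W0E] := @fps_inv _ (W 0) (W 0 0)^-1; first by rewrite W00 mulfV.
have [W' WE] := fps_inv W0E.
have -> : gram_series q Y e q' Y' e' = W' * (W * gram_series q Y e q' Y' e').
  by rewrite mulrA [W' * W]mulrC WE mul1r.
rewrite /W (gram_series_mul Y Y' ue pf ue' pf') qPh qPh'.
set Z := \prod_s e s; set Z' := \prod_s e' s.
have -> : W' * (finl h ^+ 2 * (finl (q * Y) * finr (fpsX ^+ k' * M' * (Y' * Z')) -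
      finl (fpsX ^+ k * M * (Y * Z)) * finr (q' * Y'))) =
    finr fpsX ^+ k' * (W' * finl h ^+ 2 * finl (q * Y) * finr (M' * (Y' * Z')))
    - finl fpsX ^+ k * (W' * finl h ^+ 2 * finl (M * (Y * Z)) * finr (q' * Y')).
  by rewrite !rmorphM !rmorphXn /=; ring.
by rewrite !fpsD !fpsN finlXnM finrXnM lt_ak lt_bk' subrr.
Qed.

(** [T] is the answer obtained on replacing Y(tau) / Y(upsilon) and its inverse by 1. The error is a
    multiple of tau - upsilon, and after cancelling this factor it keeps tau^k or upsilon^k,
    invisible at orders below k. The sign [eps] is 1 at mu_i and -1 at infinity. *)
Lemma gram_same p q Y Ph e k M (eps : fps (fps K)) T a b :
  inv_identity p q e -> pf_identity q Ph e -> q * Ph = fpsX ^+ k * M ->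
  Y * (Y * \prod_s e s) = 1 ->
  finl p * finr q - finl q * finr p = eps * (finl fpsX - finr fpsX) ->
  eps * eps = 1 ->
  (finl fpsX - finr fpsX) * T = finl h ^+ 2 *
     eps * (finl q * finr (q * Ph) - finl (q * Ph) * finr q) ->
  (a < k)%N -> (b < k)%N ->
  gram_series q Y e q Y e b a = T b a.
Proof.
move=> ue pf qPh YZ W eps2 TE lt_ak lt_bk.
have := gram_series_mul Y Y ue pf ue pf; rewrite W.
set Z := Y * \prod_s e s in YZ *; set G := gram_series _ _ _ _ _ _ => GE.
have BE := divdiffE Y; set B := divdiff Y in BE.
set X := finl fpsX - finr fpsX in GE TE W BE.
have Yl : finl Y = finr Y + X * B by rewrite -BE addrC subrK.
have Zl : finl Y * finl Z = 1 by rewrite -rmorphM YZ rmorph1.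
have Zr : finr Y * finr Z = 1 by rewrite -rmorphM YZ rmorph1.
have YZl : finl Y * finr Z = 1 + X * B * finr Z by rewrite Yl mulrDl Zr.
have ZYl : finl Z * finr Y = 1 - X * B * finl Z.
  by rewrite -[1]Zl Yl; ring.
have XG : X * G = finl h ^+ 2 * eps * (finl q * finr (q * Ph) * (finl Y * finr Z) -
    finl (q * Ph) * finr q * (finl Z * finr Y)).
  transitivity (eps * (eps * X * G)); first by rewrite mulrA mulrA eps2 mul1r.
  by rewrite GE !rmorphM /=; ring.
have /subX_eq0 : X * (G - T - finl h ^+ 2 * eps * B *
    (finl q * finr (q * Ph) * finr Z + finl (q * Ph) * finr q * finl Z)) = 0.
  rewrite mulrBr mulrBr XG TE YZl ZYl; ring.
move/eqP; rewrite subr_eq0 subr_eq => /eqP ->; rewrite qPh.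
have -> : finl h ^+ 2 * eps * B * (finl q * finr (fpsX ^+ k * M) * finr Z +
      finl (fpsX ^+ k * M) * finr q * finl Z) =
    finr fpsX ^+ k * (finl h ^+ 2 * eps * B * finl q * finr M * finr Z) +
    finl fpsX ^+ k * (finl h ^+ 2 * eps * B * finl M * finr q * finl Z).
  by rewrite !rmorphM !rmorphXn /=; ring.
by rewrite !fpsD finlXnM finrXnM lt_ak lt_bk !add0r.
Qed.

End Series.

(** * Christoffel symbols of the diagonal metric *)

Lemma invmx_diag_mx (F : fieldType) n (d : 'rV[F]_n) :
  (forall s, d 0 s != 0) -> invmx (diag_mx d) = diag_mx (\row_s (d 0 s)^-1).
Proof.
move=> d0; have E : diag_mx d *m diag_mx (\row_s (d 0 s)^-1) = 1%:M.
  apply/matrixP => i j; rewrite mul_diag_mx !mxE.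
  by case: eqP => _; rewrite ?mulr0n ?mulr0 // mulr1n mulfV.
have [u _] := mulmx1_unit E.
by rewrite -[LHS]mulmx1 -E mulmxA mulVmx // mul1mx.
Qed.

Section DiagonalChristoffel.
Variables (K : numFieldType) (n : nat) (x w dl : 'I_n -> K).
Hypothesis x_inj : injective x.
Hypothesis w_neq0 : forall s, w s != 0.
Implicit Types i j k s : 'I_n.

(* [dmetric i j k] is the derivative in [x i] of the covariant component
   g_jk, where g_jj = 1 / w j and [dl] collects the logarithmic derivatives
   of g_ii in [x i]. *)
Definition dmetric i j k : K :=
  if j == k then (if i == j then dl i / w i else - (w j)^-1 / (x j - x i)) else 0.

Definition christoffel_diag k i j : K :=
  2^-1 * w k * (dmetric i j k + dmetric j i k - dmetric k i j).

(** Only k = i and k = j contribute. The weights cancel, because the derivative of g_jj in x_i is a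
    multiple of g_jj. *)
Lemma sum_christoffel_off (dY : 'I_n -> K) i j : i != j ->
  \sum_k christoffel_diag k i j * dY k =
  - (2^-1 / (x i - x j) * (dY i - dY j)).
Proof.
move=> ij; have xij : x i - x j != 0 by rewrite subr_eq0 (inj_eq x_inj).
have xji : x j - x i != 0 by rewrite -opprB oppr_eq0.
rewrite (bigD1 i) // (bigD1 j) 1?eq_sym //= big1 => [|k /andP[ki kj]].
  rewrite addr0 /christoffel_diag /dmetric !eqxx [j == i]eq_sym (negPf ij).
  by field; rewrite xij xji !w_neq0.
rewrite /christoffel_diag /dmetric (negPf ij).
by rewrite [j == k]eq_sym (negPf kj) [i == k]eq_sym (negPf ki) subr0 addr0 mulr0 mul0r.
Qed.

Lemma sum_christoffel_diag (dY : 'I_n -> K) i :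
  \sum_k christoffel_diag k i i * dY k = 2^-1 * dl i * dY i +
  \sum_(s | s != i) 2^-1 * (w s / w i / (x i - x s)) * dY s.
Proof.
rewrite (bigD1 i) //=; congr (_ + _).
  by rewrite /christoffel_diag /dmetric !eqxx; field; exact: w_neq0.
apply: eq_bigr => s si.
rewrite /christoffel_diag /dmetric eqxx [i == s]eq_sym (negPf si).
by rewrite addr0 sub0r !mulNr opprK !mulrA.
Qed.

End DiagonalChristoffel.

Section Metric.
Variables (R : realType) (n : nat).
Local Notation C := (CC R).
Local Open Scope classical_set_scope.
Local Open Scope ring_scope.
Variables (P : {poly C}) (U : set 'rV[C]_n).
Hypothesis Uo : open U.
Hypothesis U_inj : forall x, U x -> injective (fun s => x 0 s).
Hypothesis U_root : forall x, U x -> forall s, P.[x 0 s] != 0.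
Implicit Types (x y : 'rV[C]_n) (i j k s : 'I_n).

Let w x s : C := residue (x 0) P s.

Lemma residue_neq0 x s : U x -> w x s != 0.
Proof.
by move=> Ux; rewrite /w /residue mulf_neq0 ?invr_eq0 ?U_root // vdm_neq0 //; exact: U_inj.
Qed.

Lemma invmx_PLC x i j : U x ->
  invmx (PLCmetric P x) i j = if i == j then (w x i)^-1 else 0.
Proof.
move=> Ux; rewrite /PLCmetric invmx_diag_mx => [|s].
  by rewrite !mxE; case: eqP => // ->.
by rewrite mxE; exact: (residue_neq0 s Ux).
Qed.

Definition dlog x i : C :=
  \sum_(j | j != i) (x 0 i - x 0 j)^-1 - (P^`()).[x 0 i] / P.[x 0 i].

Lemma is_derive_inv_residue x i j : U x ->
  is_derive x (delta_mx 0 i) (fun y => (w y j)^-1)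
    (if i == j then dlog x i / w x i else - (w x j)^-1 / (x 0 j - x 0 i)).
Proof.
move=> Ux; have xi := U_inj Ux.
have -> : (fun y => (w y j)^-1) =
    (fun y => (\prod_(s | s != j) (y 0 j - y 0 s)) * P.[y 0 j]^-1).
  by apply/funext => y; rewrite /w /residue invfM invrK mulrC.
have d0 s : s != j -> x 0 j - x 0 s != 0.
  by rewrite subr_eq0 eq_sym (inj_eq xi).
have d1 s : is_derive x (delta_mx 0 i) (fun y => y 0 j - y 0 s)
    ((j == i)%:R - (s == i)%:R).
  exact: is_deriveB (is_derive_coord x i j) (is_derive_coord x i s).
have d2 := is_derive_hornerf P (is_derive_coord x i j).
have d3 := is_deriveMf (is_derive_prodf (index_enum _) (fun s _ => d1 s) d0)
   (is_deriveVf (f := fun y => P.[y 0 j]) (U_root Ux j) d2).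
apply: is_derive_eq d3 _.
have Px := U_root Ux j; have vj := vdm_neq0 xi j.
rewrite -/(vdm (x 0) j) /dlog /w /residue.
case: (eqVneq i j) => [->|ij].
  rewrite (eq_bigr (fun s => (x 0 j - x 0 s)^-1)) => [|s sj].
    by rewrite mulr1n; field; rewrite Px vj.
  by rewrite (negPf sj) subr0 div1r.
rewrite (bigD1 i) //= eqxx big1 => [|s /andP[_ si]].
  by rewrite !mulr0n mulr1n; field; rewrite d0 // Px vj.
by rewrite (negPf si) subr0 mul0r.
Qed.

Lemma pd_invmx_PLC x i j k : U x ->
  pd i (fun y => invmx (PLCmetric P y) j k) x =
  dmetric (x 0) (w x) (dlog x) i j k.
Proof.
move=> Ux; rewrite /pd /dmetric.
have nU : \forall y \near x, U y by exact: open_nbhs_nbhs.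
case: eqP => [<-|/eqP/negPf jk].
  have d := is_derive_inv_residue i j Ux.
  have [_ <-] := d; apply: near_eq_derive.
  by apply: filterS nU => y Uy; rewrite invmx_PLC // eqxx.
rewrite -[RHS](derive_cst (0 : C) x (delta_mx 0 i)); apply: near_eq_derive.
by apply: filterS nU => y Uy; rewrite invmx_PLC // jk.
Qed.

Lemma christoffel_PLC x k i j : U x ->
  christoffel (PLCmetric P) x k i j =
  christoffel_diag (x 0) (w x) (dlog x) k i j.
Proof.
move=> Ux; rewrite /christoffel_diag -!(pd_invmx_PLC _ _ _ Ux).
rewrite /christoffel (bigD1 k) //= big1 => [|l lk].
  by rewrite addr0 mulrA; congr (_ * _ * _); rewrite !mxE eqxx mulr1n.
by rewrite /PLCmetric !mxE eq_sym (negPf lk) mulr0n mul0r.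
Qed.

Lemma hessian_PLC x (Y : 'rV[C]_n -> C) i j : U x ->
  hessian (PLCmetric P) Y x i j = pd i (pd j Y) x -
  \sum_k christoffel_diag (x 0) (w x) (dlog x) k i j * pd k Y x.
Proof.
move=> Ux; rewrite /hessian; congr (_ - _).
by apply: eq_bigr => k _; rewrite christoffel_PLC.
Qed.

(** The sum of the 1 / (x_i - x_j) cancels against the one inside P'(x_i) / P(x_i), which leaves the
    form of [L] in [hess_diag_series]. *)
Lemma dlogE x i : U x -> (size P <= n.+1)%N ->
  dlog x i = - (P`_n + \sum_(s | s != i) w x s / (x 0 i - x 0 s)) / w x i.
Proof.
move=> Ux sP; have xi := U_inj Ux.
have Px := U_root Ux i; have vi := vdm_neq0 xi i.
rewrite /dlog (deriv_partial_fractions xi i sP) /w.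
move: (\sum_(s | _) residue _ _ _ / _) (\sum_(s | _) _^-1) => S S'.
by rewrite /residue; field; rewrite Px vi.
Qed.

Lemma cometric_PLC x (F H : 'rV[C]_n -> C) :
  cometric (PLCmetric P) F H x = \sum_s w x s * pd s F x * pd s H x.
Proof.
rewrite /cometric; apply: eq_bigr => s _; rewrite (bigD1 s) //= big1 => [|j js].
  by rewrite addr0 !mxE eqxx mulr1n.
by rewrite !mxE eq_sym (negPf js) mulr0n !mul0r.
Qed.

End Metric.

(** * Coefficients of the Hessian identities *)

Section Coefficients.
Variables (K : numFieldType) (n : nat) (x : 'I_n -> K) (w : 'I_n -> K) (lead : K).
Hypothesis x_inj : injective x.
Hypothesis w_neq0 : forall s, w s != 0.
Variables (p q Y Ph : fps K) (e : 'I_n -> fps K).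
Hypothesis ue : inv_identity x p q e.
Hypothesis pf : pf_identity w lead q Ph e.
Implicit Types (i j s : 'I_n).

Let h : fps K := fpsC 2^-1.

Lemma hess_off_coef i j a : i != j ->
  (h ^+ 2 * q ^+ 2 * Y * e j * e i) a +
  2^-1 / (x i - x j) * (dser q Y e i a - dser q Y e j a) = 0.
Proof.
move=> ij; have := congr1 (fun f : fps K => f a) (hess_off_series x_inj Y ue ij).
by rewrite fpsD fpsCM fpsD fpsN [X in X a + _]mulrAC.
Qed.

Lemma hess_diag_coef i L k M a :
  L = - (lead + \sum_(s | s != i) w s / (x i - x s)) / w i ->
  q * Ph = fpsX ^+ k * M -> (a < k)%N ->
  (- (h ^+ 2 * q ^+ 2 * Y * e i ^+ 2)) a - 2^-1 * L * dser q Y e i a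
  - \sum_(s | s != i) 2^-1 * (w s / w i / (x i - x s)) * dser q Y e s a = 0.
Proof.
move=> LE qPh lt_ak.
have swap (Z : fps K) : Z * (fpsX ^+ k * M) = fpsX ^+ k * (Z * M) by ring.
have := congr1 (fun f : fps K => f a) (hess_diag_series x_inj w_neq0 Y ue pf LE).
rewrite qPh swap fpsXnM lt_ak => H; rewrite -[RHS]H.
rewrite !fpsD !fpsN fpsCM fps_sum; congr (_ - _ - _).
by apply: eq_bigr => s _; rewrite fpsCM.
Qed.

End Coefficients.

Section ShiftedFractions.
Variables (K : numFieldType) (n m : nat) (x : 'rV[K]_n).
Variables (k : 'I_m -> nat) (mu : 'I_m -> K) (c : K).
Hypothesis x_inj : injective (fun s => x 0 s).
Hypothesis le_k : (\sum_i k i <= n)%N.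
Variables (p q : {poly K}) (a : K) (e : 'I_n -> fps K).
Hypothesis q0 : q != 0.
Hypothesis ue : forall s, fser p q a s x * e s = 1.

Definition homser : fps K := fps_poly (homP n k mu c p q \Po ('X + a%:P)).

(** The polynomial identity is expanded at [a] and multiplied by all the inverses [e j]; in the
    summand s only [e s] survives. *)
Lemma pf_identity_homser : pf_identity (residue (x 0) (prootsP k mu c))
  (prootsP k mu c)`_n (qser q a) homser e.
Proof.
have uE (Q : pred 'I_n) : \prod_(s | Q s) fser p q a s x =
    fps_poly ((\prod_(s | Q s) (p - x 0 s *: q)) \Po ('X + a%:P)).
  rewrite (rmorph_prod (comp_poly _)) rmorph_prod /=.
  by apply: eq_bigr => s _; rewrite fserE.
have prod1 : \prod_s fser p q a s x * \prod_s e s = 1.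
  by rewrite -big_split big1 // => s _; exact: ue.
have prodC s : (\prod_(j | j != s) fser p q a j x) * \prod_j e j = e s.
  rewrite [X in _ * X](bigD1 s) //= mulrCA -big_split big1 ?mulr1 // => j _.
  exact: ue.
have H := homP_partial_fractions mu c x_inj le_k p q0.
have : homser - fpsC (prootsP k mu c)`_n * \prod_s fser p q a s x =
    \sum_s fpsC (residue (x 0) (prootsP k mu c) s) *
      (qser q a * \prod_(j | j != s) fser p q a j x).
  have := congr1 (fun P : {poly K} => fps_poly (P \Po ('X + a%:P))) H.
  rewrite comp_polyB rmorphB /= -/homser comp_polyZ -mul_polyC rmorphM /= -(uE predT) => ->.
  rewrite (rmorph_sum (comp_poly _)) rmorph_sum /=; apply: eq_bigr => s _.
  by rewrite (uE (fun j => j != s)) /qser /fpsC -!rmorphM /= comp_polyZ -mul_polyC !comp_polyM.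
move/eqP; rewrite subr_eq => /eqP homE.
rewrite /pf_identity homE mulrDl -mulrA prod1 mulr1 addrC; congr (_ + _).
by rewrite mulr_suml; apply: eq_bigr => s _; rewrite -!mulrA prodC.
Qed.

End ShiftedFractions.

Lemma tcoef_sub (R : realType) (p : {poly CC R}) (a : CC R) (n k : nat) :
  tcoef p a (n%:Z - k%:Z) = if (n < k)%N then 0 else (p^`N(n - k)).[a].
Proof.
case: ltnP => [lt_nk|le_kn]; last by rewrite subzn.
have -> : (n%:Z - k%:Z)%R = Negz (k - n).-1 by lia.
by [].
Qed.

(** * Linear independence from a Gram matrix *)

Section Rank.
Variables (K : fieldType) (T : finType).

Lemma row_free_enum (n : nat) (F : T -> 'I_n -> K) :
  (forall v : T -> K, (forall s, \sum_a v a * F a s = 0) -> v =1 (fun=> 0)) ->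
  row_free (\matrix_(a < #|T|, s < n) F (enum_val a) s).
Proof.
move=> H; apply: inj_row_free => v /rowP vF.
have /H v0 : forall s, \sum_a v 0 (enum_rank a) * F a s = 0.
  move=> s; have := vF s; rewrite !mxE => vFs; rewrite -[RHS]vFs.
  rewrite (reindex (@enum_val T predT)) /=; last first.
    by exists enum_rank => a _; [exact: enum_valK|exact: enum_rankK].
  by apply: eq_bigr => a _; rewrite enum_valK !mxE.
by apply/rowP => a; have := v0 (enum_val a); rewrite enum_valK !mxE.
Qed.

(** A linear relation between the rows of F is, after pairing with each row, a relation between the
    rows of G. *)
Lemma row_free_gram (n : nat) (F : T -> 'I_n -> K) (w : 'I_n -> K)
    (G : T -> T -> K) :
  (forall a b, \sum_s w s * F a s * F b s = G a b) ->
  (forall v : T -> K, (forall b, \sum_a v a * G a b = 0) -> v =1 (fun=> 0)) ->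
  row_free (\matrix_(a < #|T|, s < n) F (enum_val a) s).
Proof.
move=> FG kerG; apply: row_free_enum => v vF; apply: kerG => b.
transitivity (\sum_s w s * (\sum_a v a * F a s) * F b s).
  under eq_bigr do rewrite -FG mulr_sumr.
  rewrite exchange_big; apply: eq_bigr => s _.
  by rewrite mulr_sumr mulr_suml; apply: eq_bigr => a _; ring.
by rewrite big1 // => s _; rewrite vF mulr0 mul0r.
Qed.

End Rank.

(** * The Gram matrix *)

Section BranchSeries.
Variables (K : numFieldType) (n m : nat) (k : 'I_m -> nat) (mu : 'I_m -> K) (c : K).

Lemma coef0_shift (p : {poly K}) a : fps_poly (p \Po ('X + a%:P)) 0 = p.[a].
Proof. by rewrite /fps_poly coef_comp_shift nderivn0. Qed.

Lemma qser1 a : qser (1 : {poly K}) a = 1.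
Proof. by rewrite /qser comp_polyC rmorph1. Qed.

Lemma pserX a : pser ('X : {poly K}) a = fpsX + fpsC a.
Proof. by rewrite /pser comp_polyX rmorphD. Qed.

Lemma serX0 : fps_poly ('X \Po ('X + 0%:P)) = fpsX :> fps K.
Proof. by rewrite comp_polyX addr0. Qed.

Lemma homser_finite i :
  qser 1 (mu i) * homser n k mu c 'X 1 (mu i) = fpsX ^+ k i *
  fps_poly ((c *: \prod_(s | s != i) ('X - (mu s)%:P) ^+ k s) \Po ('X + (mu i)%:P)).
Proof.
rewrite qser1 mul1r /homser -rmorphXn -rmorphM /=; congr fps_poly.
have -> : homP n k mu c 'X 1 = ('X - (mu i)%:P) ^+ k i *
    (c *: \prod_(s | s != i) ('X - (mu s)%:P) ^+ k s).
  rewrite /homP expr1n mul1r (bigD1 i) //= alg_polyC scalerAr; congr (_ * (_ *: _)).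
  by apply: eq_bigr => s _; rewrite alg_polyC.
rewrite comp_polyM; congr (_ * _).
by rewrite rmorphXn /= comp_polyB comp_polyX comp_polyC addrK.
Qed.

(** Of the d + 1 factors tau, d come from the power of q inside [homP] and one from the q in
    front. *)
Lemma homser_infinite :
  qser 'X 0 * homser n k mu c 1 'X 0 = fpsX ^+ (n - \sum_i k i).+1 *
  fps_poly ((c *: \prod_i (1 - mu i *: 'X) ^+ k i) \Po ('X + 0%:P)).
Proof.
rewrite /qser serX0 /homser exprS -mulrA; congr (_ * _).
by rewrite polyC0 addr0 !comp_polyXr -rmorphXn -rmorphM /= /homP scalerAr.
Qed.

End BranchSeries.

Section GramKernel.
Variables (R : realType) (m : nat) (k : 'I_m -> nat) (d : nat).
Variables (c : CC R) (mu : 'I_m -> CC R).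

Lemma Gram_finite i (a b : 'I_(k i)) :
  Gram mu c (inl (existT _ i a) : Idx k d) (inl (existT _ i b)) =
  if ((a + b).+1 < k i)%N then 0 :> CC R
  else c * ((Ptilde k mu i)^`N((a + b).+1 - k i)).[mu i].
Proof.
rewrite /= eqxx; have -> : ((a : nat)%:Z + (b : nat)%:Z - (k i)%:Z + 1)%R =
    ((a + b).+1%:Z - (k i)%:Z)%R by lia.
by rewrite tcoef_sub; case: ifP => _; rewrite ?mulr0.
Qed.

Lemma Gram_infinite (a b : 'I_d) :
  Gram mu c (inr a : Idx k d) (inr b) =
  if ((a + b).+1 < d)%N then 0 :> CC R
  else - c * ((Rpoly k mu)^`N((a + b).+1 - d)).[0].
Proof.
rewrite /=; have -> : ((a.+1)%:Z + (b.+1)%:Z - d%:Z - 1)%R =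
    ((a + b).+1%:Z - d%:Z)%R by lia.
by rewrite tcoef_sub; case: ifP => _; rewrite ?mulr0.
Qed.

Hypothesis c0 : c != 0.
Hypothesis mu_inj : injective mu.

(* Each diagonal block is a Hankel matrix with zeros above a nonzero
   antidiagonal, so the coordinates of [v] in it vanish one by one, starting
   from the last. *)
Lemma Gram_kernel (v : Idx k d -> CC R) :
  (forall b, \sum_a v a * Gram mu c a b = 0) -> v =1 (fun=> 0).
Proof.
move=> vG [[i a]|a].
- have [r] := ubnP (k i - a)%N; elim: r a => // r IH a lt_ar.
  (* Column k_i - 1 - a meets the antidiagonal in row a, with entry c times the value of [Ptilde] at
     mu_i, nonzero since the mu are distinct. *)
  have b_lt : ((k i - a).-1 < k i)%N by have := ltn_ord a; lia.
  have := vG (inl (existT _ i (Ordinal b_lt))).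
  rewrite (bigD1 (inl (existT _ i a))) // big1 => [|b /andP[_ ba]].
    rewrite Gram_finite /= ifF; last by have := ltn_ord a; lia.
    have -> : ((a + (k i - a).-1).+1 - k i)%N = 0 by have := ltn_ord a; lia.
    rewrite nderivn0 addr0 => /eqP; rewrite mulf_eq0 => /orP[/eqP //|].
    rewrite mulf_eq0 (negPf c0) /Ptilde horner_prod.
    rewrite prodf_seq_eq0 => /hasP[s _ /andP[si]].
    by rewrite horner_exp hornerXsubC expf_eq0 subr_eq0 (inj_eq mu_inj) eq_sym (negPf si) andbF.
  case: b ba => [[i' b] ba|b _]; last by rewrite /= mulr0.
  have [ii|ii] := eqVneq i' i; last by rewrite /= (negPf ii) mulr0.
  subst i'; rewrite Gram_finite /=.
  have [lt_ba|lt_ab|ab] := ltngtP b a.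
  + by rewrite ifT ?mulr0 //; have := ltn_ord a; lia.
  + by rewrite IH ?mul0r //; have := ltn_ord b; lia.
  + by move: ba; rewrite (val_inj ab) eqxx.
- have [r] := ubnP (d - a)%N; elim: r a => // r IH a lt_ar.
  (* The antidiagonal entry is now - c, as [Rpoly] takes the value 1 at 0. *)
  have b_lt : ((d - a).-1 < d)%N by have := ltn_ord a; lia.
  have := vG (inr (Ordinal b_lt)).
  rewrite (bigD1 (inr a)) // big1 => [|b /andP[_ ba]].
    rewrite Gram_infinite /= ifF; last by have := ltn_ord a; lia.
    have -> : ((a + (d - a).-1).+1 - d)%N = 0 by have := ltn_ord a; lia.
    rewrite nderivn0 addr0 => /eqP; rewrite mulf_eq0 => /orP[/eqP //|].
    rewrite mulf_eq0 oppr_eq0 (negPf c0) /Rpoly horner_prod.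
    rewrite prodf_seq_eq0 => /hasP[s _ /=].
    by rewrite !hornerE expf_eq0 ?mulr0 subr0 oner_eq0 andbF.
  case: b ba => [[i' b] _|b ba]; first by rewrite /= mulr0.
  rewrite Gram_infinite /=.
  have [lt_ba|lt_ab|ab] := ltngtP b a.
  + by rewrite ifT ?mulr0 //; have := ltn_ord a; lia.
  + by rewrite IH ?mul0r //; have := ltn_ord b; lia.
  + by move: ba; rewrite (val_inj ab) eqxx.
Qed.

End GramKernel.

Section GramSame.
Variables (K : numFieldType) (n : nat) (x w : 'I_n -> K) (lead : K).
Variables (Y Ph M : fps K) (e : 'I_n -> fps K) (k : nat).
Hypothesis YZ : Y * (Y * \prod_s e s) = 1.

Let hE2 : finl (fpsC 2^-1 : fps K) ^+ 2 = finl (fpsC 4^-1).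
Proof. by rewrite -!rmorphXn /=; congr (finl (fpsC _)); field. Qed.

(** With q = 1, p q' - q p' is tau - upsilon, and [T] is -1/4 of the divided difference of Ph. *)
Lemma gram_finite (p : fps K) mu a b : p = fpsX + fpsC mu ->
  inv_identity x p 1 e -> pf_identity w lead 1 Ph e -> 1 * Ph = fpsX ^+ k * M ->
  (a < k)%N -> (b < k)%N ->
  \sum_s w s * dser 1 Y e s a * dser 1 Y e s b =
  if ((a + b).+1 < k)%N then 0 else - 4^-1 * M ((a + b).+1 - k)%N.
Proof.
move=> pE ue pf PhE lt_ak lt_bk; rewrite -gram_seriesE.
rewrite (@gram_same _ _ x w lead p 1 Y Ph e k M 1
  (- (finl (fpsC 4^-1) * divdiff Ph)) a b) //.
- rewrite mul1r in PhE.
  rewrite fpsN fpsN finl_coef fpsCM /divdiff PhE fpsXnM; case: ifP => _.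
    by rewrite mulr0 oppr0.
  by rewrite mulNr.
- rewrite pE (rmorphD (@finl K)) (rmorphD (@finr K)) /= finlC.
  by rewrite !rmorph1; ring.
- by rewrite mulr1.
- transitivity (- (finl (fpsC 4^-1) * (finl Ph - finr Ph))).
    by rewrite (divdiffE Ph); ring.
  by rewrite hE2 !mul1r !rmorph1; ring.
Qed.

(** With p = 1 and q = tau, p q' - q p' is upsilon - tau, which flips the sign, and [T] gains a
    factor tau upsilon, absorbed by the orders a + 1 and b + 1. *)
Lemma gram_infinite a b :
  inv_identity x 1 fpsX e -> pf_identity w lead fpsX Ph e ->
  fpsX * Ph = fpsX ^+ k.+1 * M -> (a < k)%N -> (b < k)%N ->
  \sum_s w s * dser fpsX Y e s a.+1 * dser fpsX Y e s b.+1 =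
  if ((a + b).+1 < k)%N then 0 else 4^-1 * M ((a + b).+1 - k)%N.
Proof.
move=> ue pf PhE lt_ak lt_bk; rewrite -gram_seriesE.
rewrite (@gram_same _ _ x w lead 1 fpsX Y Ph e k.+1 M (-1)
  (finl (fpsC 4^-1) * (finl fpsX * (finr fpsX * divdiff Ph))) a.+1 b.+1) //.
- have PhX : Ph = fpsX ^+ k * M.
    apply/funext => i; have := congr1 (fun f : fps K => f i.+1) PhE.
    by rewrite exprS -mulrA !fpsXM.
  rewrite finl_coef fpsCM finl_coef fpsXM finrX fpsXM /divdiff PhX fpsXnM.
  by case: ifP => _; rewrite ?mulr0.
- by rewrite !rmorph1; ring.
- by rewrite mulrNN mulr1.
- rewrite hE2 (rmorphM (@finl K)) (rmorphM (@finr K)) /=.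
  transitivity (finl (fpsC 4^-1) * finl fpsX * finr fpsX * (finl Ph - finr Ph)).
    by rewrite (divdiffE Ph); ring.
  by ring.
Qed.

End GramSame.

Lemma det_shift_diag (K : comNzRingType) n (x : 'rV[K]_n) (t : K) :
  \det (t%:M - diag_mx x) = (\prod_s ('X - x 0 s *: 1)).[t].
Proof.
have -> : t%:M - diag_mx x = diag_mx (\row_s (t - x 0 s)).
  apply/matrixP => i j; rewrite !mxE.
  by case: eqP => [->|_]; rewrite ?mulr1n // !mulr0n subr0.
rewrite det_diag horner_prod; apply: eq_bigr => s _.
by rewrite mxE !hornerE.
Qed.

Lemma det_one_sub_diag (K : comNzRingType) n (x : 'rV[K]_n) (t : K) :
  \det (1%:M - t *: diag_mx x) = (\prod_s (1 - x 0 s *: 'X)).[t].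
Proof.
have -> : 1%:M - t *: diag_mx x = diag_mx (\row_s (1 - x 0 s * t)).
  apply/matrixP => i j; rewrite !mxE.
  case: eqP => [->|_]; first by rewrite !mulr1n [t * _]mulrC.
  by rewrite !mulr0n mulr0 subr0.
rewrite det_diag horner_prod; apply: eq_bigr => s _.
by rewrite mxE !hornerE.
Qed.

(** * Flat coordinates *)

Section FlatCoordinates.
Variables (R : realType) (n m : nat) (k : 'I_m -> nat).
Local Notation C := (CC R).
Local Open Scope classical_set_scope.
Local Open Scope ring_scope.
Variables (c : C) (mu : 'I_m -> C) (U : set 'rV[C]_n).
Variables (sigma : 'I_m -> 'rV[C]_n -> C -> C) (sigmainf : 'rV[C]_n -> C -> C).
Hypothesis c0 : c != 0.
Hypothesis mu_inj : injective mu.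
Hypothesis le_k : (\sum_i k i <= n)%N.
Hypothesis Uo : open U.
Hypothesis U_inj : forall x, U x -> injective (fun s : 'I_n => x 0 s).
Hypothesis U_mu : forall x, U x -> forall i s, x 0 s != mu i.
Hypothesis sigmaP : forall i x, U x -> \forall z \near (x, mu i),
  {for z, continuous (fun q : 'rV[C]_n * C => sigma i q.1 q.2)} /\
  sigma i z.1 z.2 ^+ 2 = \det (z.2%:M - diag_mx z.1).
Hypothesis sigmainfP : forall x, U x -> \forall z \near (x, 0),
  {for z, continuous (fun q : 'rV[C]_n * C => sigmainf q.1 q.2)} /\
  sigmainf z.1 z.2 ^+ 2 = \det (1%:M - z.2 *: diag_mx z.1).

Let d := (n - \sum_i k i)%N.
Let P : {poly C} := Ppoly k mu c.
Let g := PLCmetric P : 'rV[C]_n -> 'M[C]_n.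
Let Y : Idx k d -> _ -> C := Yfun mu sigma sigmainf (d := d).

(* [Some i] stands for the expansion at [mu i] and [None] for the one at
   infinity; the factors of the determinant are [bp - x_s bq]. *)
Let bp (o : option 'I_m) : {poly C} := if o is Some _ then 'X else 1.
Let bq (o : option 'I_m) : {poly C} := if o is Some _ then 1 else 'X.
Let bc (o : option 'I_m) : C := if o is Some i then mu i else 0.
Let bs (o : option 'I_m) := if o is Some i then sigma i else sigmainf.
Let bk (o : option 'I_m) : nat := if o is Some i then k i else d.+1.
Let bM (o : option 'I_m) : fps C :=
  if o is Some i then fps_poly (((-4 * c) *: Ptilde k mu i) \Po ('X + (mu i)%:P))
  else fps_poly (((-4 * c) *: Rpoly k mu) \Po ('X + 0%:P)).
Let bh o : fps C := homser n k mu (-4 * c) (bp o) (bq o) (bc o).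

Let br (a : Idx k d) : option 'I_m := if a is inl (existT i _) then Some i else None.
Let ba (a : Idx k d) : nat :=
  match a with inl (existT _ al) => al | inr j => j.+1 end.

Let lt_bk a : (ba a < bk (br a))%N.
Proof. by case: a => [[i al]|j] //=; rewrite ltnS. Qed.

Let U_root x : U x -> forall s, P.[x 0 s] != 0.
Proof.
move=> Ux s; rewrite hornerZ mulf_neq0 //.
  by rewrite mulf_neq0 // oppr_eq0 pnatr_eq0.
rewrite horner_prod; apply/prodf_neq0 => i _.
by rewrite horner_exp hornerXsubC expf_neq0 // subr_eq0 U_mu.
Qed.

Let bq0 o : bq o != 0.
Proof. by case: o => [i|]; rewrite /= ?oner_eq0 ?polyX_eq0. Qed.

Let bsP o x : U x -> \forall z \near (x, bc o),
  {for z, continuous (fun q : 'rV[C]_n * C => bs o q.1 q.2)} /\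
  bs o z.1 z.2 ^+ 2 = (\prod_s (bp o - z.1 0 s *: bq o)).[z.2].
Proof.
case: o => [i|] Ux.
  by apply: filterS (sigmaP i Ux) => z []; rewrite det_shift_diag.
by apply: filterS (sigmainfP Ux) => z []; rewrite det_one_sub_diag.
Qed.

Let pq_neq0 o x : U x -> forall s, (bp o).[bc o] - x 0 s * (bq o).[bc o] != 0.
Proof.
case: o => [i|] Ux s /=; rewrite hornerX hornerC ?mulr0 ?subr0 ?oner_eq0 //.
by rewrite mulr1 subr_eq0 eq_sym U_mu.
Qed.

Let bhE o : qser (bq o) (bc o) * bh o = fpsX ^+ bk o * bM o.
Proof.
case: o => [i|]; first exact: homser_finite.
exact: homser_infinite.
Qed.

Lemma branch_inverses : exists e : option 'I_m -> 'I_n -> 'rV[C]_n -> fps C,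
  forall o x, U x -> forall s, fser (bp o) (bq o) (bc o) s x * e o s x = 1.
Proof.
have H o := fser_inv (@pq_neq0 o).
by have [e eP] := choice H; exists e => o; exact: eP.
Qed.

Variable e : option 'I_m -> 'I_n -> 'rV[C]_n -> fps C.
Hypothesis eP : forall o x, U x -> forall s,
  fser (bp o) (bq o) (bc o) s x * e o s x = 1.

Let yd o x s : fps C :=
  dser (qser (bq o) (bc o)) (tser (bc o) (bs o) x) (fun s => e o s x) s.

Let Y_derive a x s : U x -> is_derive x (delta_mx 0 s) (Y a) (yd (br a) x s (ba a)).
Proof.
move=> Ux; have := tser_derive Uo (@bsP (br a)) (@pq_neq0 (br a)) (@eP (br a)) s Ux.
move=> /(_ (ba a)); case: a => [[i al]|j] //= H.
(* At infinity the subtracted R^(alpha) is constant in x. *)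
have := is_deriveB H (is_derive_cst (tcoef (Rpoly k mu) 0 (Posz j.+1)) x (delta_mx 0 s)).
by rewrite subr0.
Qed.

Let pdY a x s : U x -> pd s (Y a) x = yd (br a) x s (ba a).
Proof. by move=> Ux; have [_] := Y_derive a s Ux. Qed.

Let pd2Y a x i j : U x -> pd i (pd j (Y a)) x =
  (if j == i then - (fpsC 2^-1 ^+ 2 * qser (bq (br a)) (bc (br a)) ^+ 2 *
       tser (bc (br a)) (bs (br a)) x * e (br a) j x ^+ 2)
   else fpsC 2^-1 ^+ 2 * qser (bq (br a)) (bc (br a)) ^+ 2 *
       tser (bc (br a)) (bs (br a)) x * e (br a) j x * e (br a) i x) (ba a).
Proof.
move=> Ux.
have := tser_derive2 Uo (@bsP (br a)) (@pq_neq0 (br a)) (@eP (br a)) j i Ux.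
move=> /(_ (ba a)) [_ <-]; rewrite /pd; apply: near_eq_derive.
have nU : \forall y \near x, U y by exact: open_nbhs_nbhs.
by apply: filterS nU => y Uy; exact: pdY.
Qed.

Let bpf o x (Ux : U x) : pf_identity (residue (x 0) P) P`_n
  (qser (bq o) (bc o)) (bh o) (fun s => e o s x).
Proof.
exact: (@pf_identity_homser _ n m x k mu (-4 * c) (U_inj Ux) le_k (bp o) (bq o)
  (bc o) (fun s => e o s x) (bq0 o) (eP o Ux)).
Qed.

Let binv o x (Ux : U x) : inv_identity (x 0) (pser (bp o) (bc o))
  (qser (bq o) (bc o)) (fun s => e o s x).
Proof. exact: eP. Qed.

Lemma hessian_eq0 a x i j : U x -> hessian g (Y a) x i j = 0.
Proof.
move=> Ux; rewrite (hessian_PLC Uo U_inj U_root) //.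
have w0 s : residue (x 0) P s != 0 by exact: (residue_neq0 U_inj U_root).
have [<-|ij] := eqVneq i j.
  rewrite (sum_christoffel_diag _ _ w0) pd2Y // eqxx opprD addrA.
  under eq_bigr do rewrite pdY //.
  rewrite pdY //.
  apply: (hess_diag_coef (U_inj Ux) w0 _ (binv (br a) Ux) (bpf (br a) Ux) _ (bhE _)) => //.
  exact: (dlogE U_inj U_root i Ux (size_prootsP _ _ le_k)).
rewrite (sum_christoffel_off _ (U_inj Ux) w0) // opprK pd2Y // eq_sym (negPf ij).
rewrite !pdY //.
exact: (hess_off_coef (U_inj Ux) _ (binv (br a) Ux)).
Qed.

Lemma cometric_Gram a b x : U x -> cometric g (Y a) (Y b) x = Gram mu c a b.
Proof.
move=> Ux; rewrite cometric_PLC.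
under eq_bigr do rewrite !pdY //.
have dist : br a != br b ->
    \sum_s residue (x 0) P s * yd (br a) x s (ba a) * yd (br b) x s (ba b) = 0.
  move=> ab; rewrite -gram_seriesE.
  apply: (gram_distinct _ _ (binv (br a) Ux) (bpf (br a) Ux) (binv (br b) Ux)
    (bpf (br b) Ux) (bhE _) (bhE _)) => //.
  rewrite /pser /qser !coef0_shift.
  (* The constant term of p q' - q p' is mu_i - mu_j for two finite points, and -1 or 1 if one of
     them is infinity. *)
  case: (br a) (br b) ab => [i|] [j|] //= ij; rewrite !(hornerX, hornerC).
  - by rewrite mulr1 mul1r subr_eq0 (inj_eq mu_inj).
  - by rewrite mulr0 mul1r sub0r oppr_eq0 oner_eq0.
  - by rewrite mulr1 mul0r subr0 oner_eq0.
have YZ o : tser (bc o) (bs o) x * (tser (bc o) (bs o) x * \prod_s e o s x) = 1.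
  exact: (tser_inv (@bsP o) (@pq_neq0 o) (@eP o) Ux).
have MfE i j : fps_poly (((-4 * c) *: Ptilde k mu i) \Po ('X + (mu i)%:P)) j =
    -4 * c * ((Ptilde k mu i)^`N(j)).[mu i].
  by rewrite /fps_poly coef_comp_shift nderivnZ hornerZ.
have MiE j : fps_poly (((-4 * c) *: Rpoly k mu) \Po ('X + 0%:P)) j =
    -4 * c * ((Rpoly k mu)^`N(j)).[0].
  by rewrite /fps_poly coef_comp_shift nderivnZ hornerZ.
case: a b dist => [[i al]|a] [[j be]|b] dist.
- have [ij|ij] := eqVneq i j; last first.
    transitivity (0 : C); last by rewrite /= (negPf ij).
    by apply: dist; rewrite /= (inj_eq Some_inj).
  subst j; rewrite Gram_finite /=.
  have ue := binv (Some i) Ux; have pf := bpf (Some i) Ux.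
  have hE := bhE (Some i); rewrite /yd /=; rewrite /= qser1 in ue pf hE *.
  rewrite (gram_finite (YZ (Some i)) (pserX (mu i)) ue pf hE) //=.
  (* The -4 in P meets -1/4 here and leaves c; at infinity it meets 1/4 and leaves - c. *)
  by rewrite MfE; case: ifP => // _; field.
- exact: dist.
- exact: dist.
- rewrite Gram_infinite.
  have ue := binv None Ux; have pf := bpf None Ux; have hE := bhE None.
  have p1 : pser (1 : {poly C}) 0 = 1 by exact: qser1.
  have qX : qser ('X : {poly C}) 0 = fpsX by exact: serX0.
  rewrite /yd /=; rewrite /= p1 qX in ue; rewrite /= qX in pf hE *.
  rewrite (gram_infinite (YZ None) ue pf hE) //=.
  by rewrite MiE; case: ifP => // _; field.
Qed.

End FlatCoordinates.

Unset Implicit Arguments.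

Theorem theorem1p5 (R : realType) (n m : nat) (k : 'I_m -> nat)
    (c : CC R) (mu : 'I_m -> CC R) (U : set 'rV[CC R]_n)
    (sigma : 'I_m -> 'rV[CC R]_n -> CC R -> CC R)
    (sigmainf : 'rV[CC R]_n -> CC R -> CC R)
    (W : 'I_m -> set ('rV[CC R]_n * CC R)%type)
    (Winf : set ('rV[CC R]_n * CC R)%type) :
  (1 <= n)%N ->
  c != 0 ->
  injective mu ->
  (\sum_(i < m) k i <= n)%N ->
  open U ->
  (* regular points: eigenvalues of L pairwise distinct and not roots of P *)
  (forall x, U x -> injective (fun s : 'I_n => x 0 s)) ->
  (forall x, U x -> forall i s, x 0 s != mu i) ->
  (* sigma i : a local branch of sqrt(det(t Id - L)) around t = mu_i *)
  (forall i, open (W i) /\ (forall x, U x -> W i (x, mu i)) /\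
     (forall p, W i p ->
        {for p, continuous (fun q : ('rV[CC R]_n * CC R)%type => sigma i q.1 q.2)} /\
        sigma i p.1 p.2 ^+ 2 = \det (p.2%:M - diag_mx p.1))) ->
  (* sigmainf : a local branch of sqrt(det(Id - t L)) around t = 0 *)
  (open Winf /\ (forall x, U x -> Winf (x, 0)) /\
     (forall p, Winf p ->
        {for p, continuous (fun q : ('rV[CC R]_n * CC R)%type => sigmainf q.1 q.2)} /\
        sigmainf p.1 p.2 ^+ 2 = \det (1%:M - p.2 *: diag_mx p.1))) ->
  let d := (n - \sum_(i < m) k i)%N in
  let g := PLCmetric (Ppoly k mu c) in
  let Y := Yfun mu sigma sigmainf (d := d) in
  (forall (a : Idx k d) x, U x -> forall i j, hessian g (Y a) x i j = 0) /\
  (forall (a b : Idx k d) x, U x -> cometric g (Y a) (Y b) x = Gram mu c a b) /\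
  (forall x, U x ->
     row_free (\matrix_(a < #|Idx k d|, s < n) pd s (Y (enum_val a)) x)) /\
  \det (\matrix_(a < #|Idx k d|, b < #|Idx k d|)
          Gram mu c (enum_val a) (enum_val b)) != 0.
Proof.
move=> _ c0 mu_inj le_k Uo U_inj U_mu HW [oWinf [UWinf WinfP]] d g Y.
have sigmaP i x (Ux : U x) : \forall z \near (x, mu i),
    {for z, continuous (fun q : ('rV[CC R]_n * CC R)%type => sigma i q.1 q.2)} /\
    sigma i z.1 z.2 ^+ 2 = \det (z.2%:M - diag_mx z.1).
  have [oW [UW WP]] := HW i.
  have nW : \forall z \near (x, mu i), W i z.
    by apply: open_nbhs_nbhs; split=> //; exact: UW.
  exact: filterS WP nW.
have sigmainfP x (Ux : U x) : \forall z \near (x, 0),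
    {for z, continuous (fun q : ('rV[CC R]_n * CC R)%type => sigmainf q.1 q.2)} /\
    sigmainf z.1 z.2 ^+ 2 = \det (1%:M - z.2 *: diag_mx z.1).
  have nW : \forall z \near (x, 0), Winf z.
    by apply: open_nbhs_nbhs; split=> //; exact: UWinf.
  exact: filterS WinfP nW.
have [e eP] := branch_inverses U_mu.
have flat := hessian_eq0 c0 le_k Uo U_inj U_mu sigmaP sigmainfP eP.
have gram := cometric_Gram c mu_inj le_k Uo U_inj U_mu sigmaP sigmainfP eP.
have ker v := @Gram_kernel R m k d c mu c0 mu_inj v.
split; first by move=> a x Ux i j; exact: flat.
split; first by move=> a b x Ux; exact: gram.
split.
  move=> x Ux.
  apply: (@row_free_gram (CC R) (Idx k d) n (fun a s => pd s (Y a) x)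
    (residue (x 0) (Ppoly k mu c)) _ _ ker) => a b.
  rewrite -(gram a b x Ux); exact/esym/cometric_PLC.
(* For a square matrix a nonzero determinant means free rows, so the trivial kernel settles this
   claim too. *)
rewrite -unitfE -[_ \in _]/(_ \in unitmx) -row_free_unit.
apply: (@row_free_enum _ (Idx k d) _ (fun a s => Gram mu c a (enum_val s))) => v vF.
by apply: ker => b; have := vF (enum_rank b); rewrite enum_rankK.
Qed.
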